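(* Let $n\ge 1$ be an integer, $q$ a prime power, and let $\mathcal{T}$ be a tight set with parameter $x$ of the hyperbolic polar space $\mathsf{Q}^+(2n+1,q)$. Then for every generator $G$ of $\mathsf{Q}^+(2n+1,q)$, the number $w:=|G\cap \mathcal{T}|$ satisfies \[ \binom{x}{2}+w(w-x)\equiv 0 \pmod{q+1} \] if $n$ is even, and \[ w(w-x)\equiv 0 \pmod{q+1} \] if $n$ is odd.
   Context: $\mathsf{Q}^+(2n+1,q)$ is the polar space of rank $n+1$ formed by the projective points of $\mathrm{PG}(2n+1,q)$ (underlying vector space $\mathbb{F}_q^{2n+2}$) satisfying $f(\mathbf{x})=x_0x_1+\cdots+x_{2n}x_{2n+1}=0$, together with the totally singular subspaces of $f$. Let $b(\mathbf{x},\mathbf{y})=f(\mathbf{x}+\mathbf{y})-f(\mathbf{x})-f(\mathbf{y})$; for a point $P$, $P^\perp$ denotes the set of points $Y$ with $b(P,Y)=0$ (so $P\in P^\perp$ for points $P$ of the quadric, and two points of the quadric are collinear iff one lies in the other's $\perp$). A generator is a maximal totally singular subspace (of projective dimension $n$). For $k\ge -1$, $\theta_k=(q^{k+1}-1)/(q-1)$. A set $\mathcal{T}$ of points of a polar space of rank $r$ over $\mathbb{F}_q$ is called tight if the average over $P\in\mathcal{T}$ of $|P^\perp\cap\mathcal{T}|$ equals $|\mathcal{T}|\frac{q^{r-1}-1}{q^r-1}+q^{r-1}$; in that case $|\mathcal{T}|=x\frac{q^r-1}{q-1}$ for a non-negative integer $x$, called the parameter of $\mathcal{T}$ (here $r=n+1$,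 so $|\mathcal{T}|=x\theta_n$). *)

(* Defs.v *)
From HB Require Import structures.
From mathcomp Require Import all_boot all_order all_algebra.

Set Implicit Arguments.
Unset Strict Implicit.
Unset Printing Implicit Defensive.

Import GRing.Theory VectorInternalTheory.

Local Open Scope ring_scope.

Section FiniteVspace.
Variables (F : finFieldType) (vT : vectType F).
HB.instance Definition _ := [Countable of {vspace vT} by <:].
HB.instance Definition _ := [Finite of {vspace vT} by <:].
End FiniteVspace.

(* Projective subspaces of PG(2n+1,q) are represented by vector subspaces of
   F_q^(2n+2), with F_q = F and q = #|F|: a point is a subspace of vector
   dimension 1, and incidence is inclusion of subspaces. *)

Definition hyp_form (F : finFieldType) (n : nat) (x : 'rV[F]_(2 * n).+2) : F :=
  \sum_(i < n.+1) x 0 (inord (2 * i)) * x 0 (inord (2 * i).+1).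

Definition hyp_bilin (F : finFieldType) (n : nat)
    (x y : 'rV[F]_(2 * n).+2) : F :=
  hyp_form (x + y) - hyp_form x - hyp_form y.

Definition tot_singular (F : finFieldType) (n : nat)
    (U : {vspace 'rV[F]_(2 * n).+2}) : Prop :=
  forall v, v \in U -> hyp_form v = 0.

Definition quadric_point (F : finFieldType) (n : nat)
    (P : {vspace 'rV[F]_(2 * n).+2}) : Prop :=
  \dim P = 1%N /\ tot_singular P.

Definition generator (F : finFieldType) (n : nat)
    (G : {vspace 'rV[F]_(2 * n).+2}) : Prop :=
  tot_singular G /\
  forall U : {vspace 'rV[F]_(2 * n).+2},
    tot_singular U -> (G <= U)%VS -> U = G.

Definition perp (F : finFieldType) (n : nat)
    (P : {vspace 'rV[F]_(2 * n).+2}) : {set {vspace 'rV[F]_(2 * n).+2}} :=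
  [set Y : {vspace 'rV[F]_(2 * n).+2} | (\dim Y == 1%N) &&
    [forall u, forall v, (u \in P) ==> (v \in Y) ==> (hyp_bilin u v == 0)]].

(* The division is exact when 1 < q. *)
Definition theta (q k : nat) : nat := ((q ^ k.+1 - 1) %/ (q - 1))%N.

Definition average (I : finType) (A : {set I}) (w : I -> nat) : rat :=
  (\sum_(i in A) (w i)%:R) / #|A|%:R.

(* The rank of the polar space is r = n + 1.  The average over the empty set is
   undefined; the empty set counts as tight, with parameter 0. *)
Definition tight (F : finFieldType) (n : nat)
    (T : {set {vspace 'rV[F]_(2 * n).+2}}) : Prop :=
  let q : rat := #|F|%:R in
  (forall P, P \in T -> quadric_point P) /\
  (T <> set0 ->
   average T (fun P => #|perp P :&: T|) =
     #|T|%:R * ((q ^+ n - 1) / (q ^+ n.+1 - 1)) + q ^+ n).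

Definition tight_with_parameter (F : finFieldType) (n : nat)
    (T : {set {vspace 'rV[F]_(2 * n).+2}}) (x : nat) : Prop :=
  tight T /\ #|T| = (x * theta #|F| n)%N.

Definition points_in (F : finFieldType) (n : nat)
    (G : {vspace 'rV[F]_(2 * n).+2}) : {set {vspace 'rV[F]_(2 * n).+2}} :=
  [set P : {vspace 'rV[F]_(2 * n).+2} | (\dim P == 1%N) && (P <= G)%VS].

(* Main.v *)
(* Coordinates W = F^N x F^N, N = n + 1, are chosen so that the form becomes
   g.z and the generator G becomes z = 0.  A sum-of-squares argument in the
   strongly regular collinearity graph turns the average condition into
   |P^perp :&: T| = x theta_(n-1) + q^n [P in T] for every point P; double
   counting extends this to |U^perp :&: T| for every totally singular U.
   For a subspace S of codimension 2 in G, the residue S^perp/S is a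
   (q+1) x (q+1) grid, and T induces on it a weight of the form r_i + c_j, where
   c_j is read off on G (row 0) and r_0 = 0.  The integer
   k(S) = sum_(i <> 0) r_i (r_i - 1) / 2 depends only on S, while its sum over
   all S can be computed exactly from x, w, q and n: summing over ordered bases
   (z1, z2) of the annihilator of S instead gives a polynomial expression that
   must be divisible by |GL_2(q)| = (q^2 - 1)(q^2 - q).  The factor q + 1 of
   this divisibility is the claimed congruence. *)
From HB Require Import structures.
Require Import Defs.
From mathcomp Require Import all_boot all_order all_algebra finfield.
From mathcomp Require Import ring zify.

Set Implicit Arguments.
Unset Strict Implicit.
Unset Printing Implicit Defensive.

Import Order.TTheory GRing.Theory Num.Theory.

Local Open Scope ring_scope.

(** * Counting with linear forms *)

(** All counts run over vectors instead of points, the zero vector carrying the value x. The values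
    r_i can be negative, but r (r - 1) / 2 is an integer for every integer r; without the halving
    the congruence would follow only for twice the expression, which is weaker for odd q. Ordered
    bases replace S because, for fixed z1, the sum over z2 becomes a count of pairs of vectors,
    corrected by the multiples of z1. The outcome is a quadratic polynomial in the number of points
    of T in the hyperplane g.z1 = 0 of G, and the first two moments of that number involve only w.
    Of |GL_2(q)| = q (q - 1)^2 (q + 1), the part q (q - 1)^2 cancels identically once q^(n-1) is
    written as 1 + (q - 1) theta. The parity of n enters only there: theta = 1 + q + ... + q^(n-2)
    is 0 or 1 modulo q + 1. *)

Definition ind (b : bool) : int := if b then 1 else 0.

Lemma indM (a b : bool) : ind (a && b) = ind a * ind b.
Proof. by case: a; rewrite ?mul1r ?mul0r. Qed.

Lemma indN (b : bool) : ind (~~ b) = 1 - ind b.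
Proof. by case: b. Qed.

Lemma ind_mull (b : bool) (x y : int) : (b -> x = y) -> ind b * x = ind b * y.
Proof. by case: b => [->//|_]; rewrite !mul0r. Qed.

Lemma sum_pick (V : finType) (v0 : V) (Phi : V -> int) :
  \sum_v ind (v == v0) * Phi v = Phi v0.
Proof.
rewrite (bigD1 v0) //= eqxx mul1r big1 ?addr0 // => v /negPf ->.
by rewrite mul0r.
Qed.

Lemma sum_pickr (V : finType) (v0 : V) (Phi : V -> int) :
  \sum_v ind (v0 == v) * Phi v = Phi v0.
Proof. by under eq_bigr do rewrite eq_sym; apply: sum_pick. Qed.

Lemma sum_indD0 (V : finType) (v0 : V) (Phi : V -> int) :
  \sum_v ind (v != v0) * Phi v = \sum_v Phi v - Phi v0.
Proof.
under eq_bigr do rewrite indN mulrBl mul1r.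
by rewrite sumrB sum_pick.
Qed.

Lemma sum_swap_mul (U V : finType) (P : U -> int) (Q : U -> V -> int) :
  \sum_u P u * \sum_v Q u v = \sum_v \sum_u P u * Q u v.
Proof. by under eq_bigr do rewrite mulr_sumr; rewrite exchange_big. Qed.

Lemma sum_mul_sum (U V : finType) (P : U -> int) (Q : V -> int) :
  (\sum_u P u) * (\sum_v Q v) = \sum_u \sum_v P u * Q v.
Proof. by rewrite mulr_suml; under eq_bigr do rewrite mulr_sumr. Qed.

Section Fiber.
Variable F : finFieldType.
Notation q := (#|F|%:Z).

Lemma q_gt1 : 1 < q.
Proof. by rewrite ltz_nat; exact: finNzRing_gt1. Qed.

Lemma q_neq0 : q != 0.
Proof. by have := q_gt1; lia. Qed.

Lemma qB1_neq0 : q - 1 != 0.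
Proof. by have := q_gt1; lia. Qed.

Lemma qD1_neq0 : q + 1 != 0.
Proof. by have := q_gt1; lia. Qed.

Lemma sum_one (V : finType) : \sum_(v : V) (1 : int) = #|V|%:Z.
Proof. by rewrite sumr_const natz. Qed.

Lemma sum_root (a k : F) : k != 0 -> \sum_l ind (a + l * k == 0) = 1.
Proof.
move=> kN0; rewrite (bigD1 (- a / k)) //= divfK // subrr eqxx big1 ?addr0 //.
move=> l lN; case: eqP => // E; case/eqP: lN.
by apply: (mulIf kN0); rewrite divfK //; apply/eqP; rewrite -addr_eq0 addrC E.
Qed.

(** Along the shifts [h] is affine in l with nonzero slope, so each z in [A] has exactly one l with
    [h (sh l z) = 0]. Every shift permutes [A], so counting the pairs (l, z) gives q times the
    number of zeros. *)
Lemma sum_ind_fiber (V : finType) (sh : F -> V -> V) (A : pred V) (h k : V ->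
  F) :
  (forall l, injective (sh l)) -> (forall l z, A (sh l z) = A z) ->
  (forall l z, A z -> h (sh l z) = h z + l * k z) ->
  (forall z, A z -> k z != 0) ->
  q * \sum_z ind (A z) * ind (h z == 0) = \sum_z ind (A z).
Proof.
move=> inj Ash hsh kN0.
transitivity (\sum_z ind (A z) * \sum_l ind (h (sh l z) == 0)); last first.
  apply: eq_bigr => z _; rewrite -[RHS]mulr1; apply: ind_mull => Az.
  by under eq_bigr do rewrite hsh //; rewrite sum_root // kN0.
rewrite [RHS]sum_swap_mul [RHS](eq_bigr (fun=> \sum_z ind (A z) * ind (h z ==
  0))); last first.
  move=> l _; rewrite [RHS](reindex_inj (inj l)) /=.
  by apply: eq_bigr => z _; rewrite Ash.
by rewrite sumr_const -mulr_natl natz.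
Qed.
End Fiber.

(** * Linear equations on row vectors *)

Section Dot.
Variable F : finFieldType.
Notation q := (#|F|%:Z).

Definition dot d (u v : 'rV[F]_d) : F := (u *m v^T) 0 0.

Lemma dotC d (u v : 'rV[F]_d) : dot u v = dot v u.
Proof. by rewrite /dot -[u *m _]trmxK trmx_mul trmxK mxE. Qed.

Lemma dotDl d (u v w : 'rV[F]_d) : dot (u + v) w = dot u w + dot v w.
Proof. by rewrite /dot mulmxDl mxE. Qed.

Lemma dotZl d a (u w : 'rV[F]_d) : dot (a *: u) w = a * dot u w.
Proof. by rewrite /dot -scalemxAl mxE. Qed.

Lemma dotDr d (u v w : 'rV[F]_d) : dot w (u + v) = dot w u + dot w v.
Proof. by rewrite dotC dotDl !(dotC w). Qed.

Lemma dotZr d a (u w : 'rV[F]_d) : dot w (a *: u) = a * dot w u.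
Proof. by rewrite dotC dotZl (dotC w). Qed.

Lemma dot0l d (u : 'rV[F]_d) : dot 0 u = 0.
Proof. by rewrite /dot mul0mx mxE. Qed.

Lemma dot0r d (u : 'rV[F]_d) : dot u 0 = 0.
Proof. by rewrite dotC dot0l. Qed.

Lemma dot_row d (g z g' z' : 'rV[F]_d) :
  dot (row_mx g z) (row_mx g' z') = dot g g' + dot z z'.
Proof. by rewrite /dot tr_row_mx mul_row_col mxE. Qed.

(** The columns of [cokermx B] vanish together exactly on the row space of [B], so one of them is
    nonzero at z. *)
Lemma exists_perp k d (B : 'M[F]_(k, d)) (z : 'rV[F]_d) : ~~ (z <= B)%MS ->
  exists2 u : 'rV[F]_d,
    forall y : 'rV[F]_d, (y <= B)%MS -> dot u y = 0 & dot u z != 0.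
Proof.
rewrite submxE => /rV0Pn [j zj].
have E y : dot (row j (cokermx B)^T) y = (y *m cokermx B) 0 j.
  by rewrite dotC /dot -tr_col trmxK colE mulmxA -colE mxE.
exists (row j (cokermx B)^T); last by rewrite E.
by move=> y; rewrite submxE E => /eqP->; rewrite mxE.
Qed.

Lemma exists_dot d (z : 'rV[F]_d) : z != 0 -> exists u, dot u z != 0.
Proof.
by rewrite -submx0 => /exists_perp[u _ uz]; exists u.
Qed.

Lemma addZ_inj d (u : 'rV[F]_d) (l : F) : injective (fun g => g + l *: u).
Proof. exact: addIr. Qed.

Lemma sum_row1 d : \sum_(g : 'rV[F]_d) (1 : int) = q ^+ d.
Proof. by rewrite sum_one card_mx mul1n -natz natrX natz. Qed.

Lemma sum_dot_shift d (A : pred 'rV[F]_d) (u z : 'rV[F]_d) a :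
  (forall l g, A (g + l *: u) = A g) -> dot u z != 0 ->
  q * \sum_g ind (A g) * ind (dot g z == a) = \sum_g ind (A g).
Proof.
move=> AE uz; under eq_bigr do rewrite -(subr_eq0 (dot _ _)).
apply: (sum_ind_fiber (sh := fun l g => g + l *: u)
  (h := fun g => dot g z - a) (k := fun=> dot u z)) => //.
- by move=> l; apply: addZ_inj.
- by move=> l g _; rewrite dotDl dotZl; ring.
Qed.

Lemma sum_dot1 d (z : 'rV[F]_d) a : z != 0 ->
  q * \sum_g ind (dot g z == a) = q ^+ d.
Proof.
move=> /exists_dot[u uz]; rewrite -sum_row1.
rewrite -(@sum_dot_shift d predT u z a) //.
by under [in RHS]eq_bigr do rewrite mul1r.
Qed.

Lemma sum_dot2 d (z1 z2 : 'rV[F]_d) a b : z1 != 0 -> ~~ (z2 <= z1)%MS ->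
  q * (q * \sum_g ind (dot g z1 == a) * ind (dot g z2 == b)) = q ^+ d.
Proof.
move=> z1N0 /exists_perp[u uz1 uz2].
rewrite (@sum_dot_shift d (fun g => dot g z1 == a) u) ?sum_dot1 //.
by move=> l g; rewrite dotDl dotZl uz1 ?submx_refl // mulr0 addr0.
Qed.

(** Membership in a line, written as a sum over scalars, can be summed against any weight by
    [sum_line]. *)
Lemma ind_dep d (z1 z2 : 'rV[F]_d) : z1 != 0 ->
  ind (z2 <= z1)%MS = \sum_l ind (z2 == l *: z1).
Proof.
move=> z1N0; case: sub_rVP => [[a ->]|N]; last first.
  by rewrite big1 // => l _; case: eqP => // E; case: N; exists l.
rewrite (bigD1 a) //= eqxx big1 ?addr0 // => l lN.
case: eqP => // /eqP; rewrite -subr_eq0 -scalerBl scaler_eq0 (negPf z1N0) orbF.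
by rewrite subr_eq0 eq_sym (negPf lN).
Qed.

Lemma sum_line d (v : 'rV[F]_d) (Phi : 'rV[F]_d -> int) :
  \sum_u (\sum_l ind (u == l *: v)) * Phi u = \sum_l Phi (l *: v).
Proof.
under eq_bigr do rewrite mulr_suml.
by rewrite exchange_big; apply: eq_bigr => l _; rewrite sum_pick.
Qed.

Lemma sum_const_off0 (Phi : F -> int) c :
  (forall l, l != 0 -> Phi l = c) -> \sum_l Phi l = Phi 0 + (q - 1) * c.
Proof.
move=> E; rewrite (bigD1 0) //=; congr (_ + _).
rewrite (eq_bigr (fun=> c)) // sumr_const -mulr_natl natz cardC1.
by rewrite predn_int ?(ltn_trans _ (finNzRing_gt1 F)).
Qed.

Lemma sum_homogeneous d (v : 'rV[F]_d) (Phi : 'rV[F]_d -> int) :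
  (forall l, l != 0 -> Phi (l *: v) = Phi v) ->
  \sum_l Phi (l *: v) = Phi 0 + (q - 1) * Phi v.
Proof.
by move=> hom; rewrite (@sum_const_off0 _ (Phi v)) ?scale0r.
Qed.

Lemma sum_scale d (a : F) (Phi : 'rV[F]_d -> int) : a != 0 ->
  \sum_g Phi g = \sum_g Phi (a *: g).
Proof. by move=> aN0; apply: reindex_inj; apply: scalerI. Qed.
End Dot.

(** * Singular vectors of the hyperbolic form *)

Section Hyperbolic.
Variables (F : finFieldType) (N : nat).
Notation W := 'rV[F]_(N + N).

(** Swapping the halves expresses [bil] through [dot], so that the counts for linear equations apply
    to perps. *)
Definition sw (p : W) : W := row_mx (rsubmx p) (lsubmx p).
Definition bil (p p' : W) : F := dot p (sw p').
Definition qf (p : W) : F := dot (lsubmx p) (rsubmx p).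

Lemma swD p p' : sw (p + p') = sw p + sw p'.
Proof. by rewrite /sw !linearD add_row_mx. Qed.

Lemma swZ a p : sw (a *: p) = a *: sw p.
Proof. by rewrite /sw !linearZ scale_row_mx. Qed.

Lemma swK : involutive sw.
Proof. by move=> p; rewrite /sw row_mxKl row_mxKr hsubmxK. Qed.

Lemma sw_eq0 p : (sw p == 0) = (p == 0).
Proof.
have sw0 : sw 0 = 0 by rewrite -(scale0r 0) swZ !scale0r.
by rewrite -(inj_eq (inv_inj swK)) swK sw0.
Qed.

Lemma sw_sub p p' : (sw p <= sw p')%MS = (p <= p')%MS.
Proof.
apply/sub_rVP/sub_rVP => -[a E]; exists a; last by rewrite E swZ.
by rewrite -[p]swK E swZ swK.
Qed.

Lemma bilE p p' :
  bil p p' = dot (lsubmx p) (rsubmx p') + dot (lsubmx p') (rsubmx p).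
Proof. by rewrite /bil -{1}[p]hsubmxK dot_row (dotC (rsubmx p)). Qed.

Lemma bilC p p' : bil p p' = bil p' p.
Proof. by rewrite !bilE addrC. Qed.

Lemma bilDl p1 p2 p : bil (p1 + p2) p = bil p1 p + bil p2 p.
Proof. exact: dotDl. Qed.

Lemma bilZl a p1 p : bil (a *: p1) p = a * bil p1 p.
Proof. exact: dotZl. Qed.

Lemma bilZr a p1 p : bil p (a *: p1) = a * bil p p1.
Proof. by rewrite bilC bilZl bilC. Qed.

Lemma bil0r p : bil p 0 = 0.
Proof. by rewrite -(scale0r 0) bilZr mul0r. Qed.

Lemma qfD p p' : qf (p + p') = qf p + qf p' + bil p p'.
Proof. by rewrite /qf !linearD dotDl !dotDr bilE; ring. Qed.

Lemma qfZ a p : qf (a *: p) = a ^+ 2 * qf p.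
Proof. by rewrite /qf !linearZ dotZl dotZr; ring. Qed.

Lemma bil_refl p : qf p = 0 -> bil p p = 0.
Proof. by rewrite bilE /qf => ->; rewrite addr0. Qed.

Lemma sum_row_mx (Phi : W -> int) :
  \sum_p Phi p = \sum_g \sum_z Phi (row_mx g z).
Proof.
rewrite pair_bigA /=; apply: reindex => /=.
exists (fun p => (lsubmx p, rsubmx p)) => [[g z] _|p _] /=.
  by rewrite row_mxKl row_mxKr.
by rewrite hsubmxK.
Qed.
End Hyperbolic.

Section Singular.
Variables (F : finFieldType) (m : nat).
Notation N := m.+2.
Notation W := 'rV[F]_(N + N).
Notation q := (#|F|%:Z).
Notation P := (q ^+ m).

Lemma expN : q ^+ N = q ^+ 2 * P. Proof. by rewrite -exprD. Qed.

Lemma expNN : q ^+ (N + N) = q ^+ 4 * P ^+ 2.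
Proof. by rewrite exprD expN; ring. Qed.

Lemma sum_singular :
  \sum_(p : W) ind (qf p == 0) = q ^+ 2 * P + (q ^+ 2 * P - 1) * (q * P).
Proof.
rewrite sum_row_mx; under eq_bigr do under eq_bigr do rewrite /qf row_mxKl
  row_mxKr dotC.
rewrite (bigD1 0) //=.
under eq_bigr do rewrite dot0r eqxx.
rewrite sum_row1 expN; congr (_ + _).
rewrite (eq_bigr (fun=> q * P)); last first.
  by move=> g gN0; apply: (mulfI (q_neq0 F)); rewrite sum_dot1 // expN; ring.
have := sumr_const (predC1 (0 : 'rV[F]_N)) (q * P).
rewrite cardC1 => ->; rewrite -mulr_natl natz predn_int ?card_mx ?mul1n
  ?expn_gt0 ?(ltn_trans _ (finNzRing_gt1 F)) //.
by rewrite -[(_ ^ _)%N%:Z]natz natrX natz expN.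
Qed.

(** Off v^perp the form is affine along u + l v with slope [bil u v], so one vector in q is singular
    there. The count on v^perp is what remains of all singular vectors. *)
Lemma sum_singular_perp (v : W) : v != 0 -> qf v = 0 ->
  \sum_u ind (qf u == 0) * ind (bil u v == 0) =
    q ^+ 2 * P ^+ 2 + q ^+ 2 * P - q * P.
Proof.
move=> vN0 fv.
have E1 : q * \sum_u ind (bil u v != 0) * ind (qf u == 0) =
  \sum_u ind (bil u v != 0).
  apply: (@sum_ind_fiber _ _ (fun l u => u + l *: v) (fun u =>
    bil u v != 0) _ (fun u => bil u v)) => //.
  - by move=> l; apply: addZ_inj.
  - by move=> l z; rewrite bilDl bilZl bil_refl // mulr0 addr0.
  - by move=> l z _; rewrite qfD qfZ fv bilZr; ring.
have E2 : q * \sum_u ind (bil u v == 0) = q ^+ 4 * P ^+ 2.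
  by rewrite sum_dot1 ?sw_eq0 // expNN.
have E3 : \sum_u ind (bil u v != 0) =
  q ^+ 4 * P ^+ 2 - \sum_u ind (bil u v == 0).
  by under eq_bigr do rewrite indN; rewrite sumrB sum_row1 expNN.
have E4 : \sum_u ind (bil u v != 0) * ind (qf u == 0) =
   \sum_(u : W) ind (qf u == 0) - \sum_u ind (qf u == 0) * ind (bil u v == 0).
  by rewrite -sumrB; apply: eq_bigr => u _; rewrite indN; ring.
rewrite sum_singular in E4.
apply: (mulfI (q_neq0 F)); apply: (mulfI (q_neq0 F)).
move: E1 E2 E3 E4; set A := \sum_u _ * _; set B := \sum_u ind (bil u v != 0);
  set C := \sum_u ind (bil u v == 0); set D := \sum_u _ * _ => E1 E2 E3 E4.
have -> : D = q ^+ 2 * P + (q ^+ 2 * P - 1) * (q * P) - A by rewrite E4; ring.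
have -> : q * (q * (q ^+ 2 * P + (q ^+ 2 * P - 1) * (q * P) - A)) =
  q * q * (q ^+ 2 * P + (q ^+ 2 * P - 1) * (q * P)) - q * (q * A) by ring.
rewrite E1 E3 mulrBr E2; ring.
Qed.

(** If v' is a multiple of v, the previous count applies. If v' is orthogonal to v and independent
    of it, shifts along v' count the singular vectors of v^perp outside v'^perp. Otherwise shifts
    along v stay inside the singular vectors of v^perp while [bil u v'] runs through F. *)
Lemma sum_singular_perp2 (v v' : W) : v != 0 -> qf v = 0 -> qf v' = 0 ->
  \sum_u ind (qf u == 0) * ind (bil u v == 0) * ind (bil u v' == 0) =
    q * P ^+ 2 + q * P - P + P * (q - 1) ^+ 2 * ind (bil v v' == 0) +
    q * P ^+ 2 * (q - 1) * ind (v' <= v)%MS.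
Proof.
move=> vN0 fv fv'; case: (boolP (v' <= v)%MS) => [/sub_rVP[a Ea]|dN].
  rewrite Ea bilZr bil_refl // mulr0 eqxx /=.
  rewrite (eq_bigr (fun u => ind (qf u == 0) * ind (bil u v == 0))).
    rewrite sum_singular_perp //; ring.
  move=> u _; rewrite bilZr; case: (altP (bil u v =P 0)) => [->|_];
    last by rewrite !(mulr0, mul0r).
  by rewrite mulr0 eqxx mulr1.
rewrite [ind false]/= mulr0 addr0;
  case: (boolP (bil v v' == 0)) => [/eqP b0|bN0].
  have E1 : q * \sum_u ind ((bil u v == 0) && (bil u v' != 0)) * ind (qf u == 0)
     = \sum_u ind ((bil u v == 0) && (bil u v' != 0)).
    apply: (@sum_ind_fiber _ _ (fun l u => u + l *: v') (fun u =>
      (bil u v == 0) && (bil u v' != 0)) _ (fun u => bil u v')) => //.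
    - by move=> l; apply: addZ_inj.
    - move=> l z; rewrite !bilDl !bilZl (bil_refl fv') (bilC v') b0.
      by rewrite mulr0 !addr0.
    - by move=> l z _; rewrite qfD qfZ fv' bilZr; ring.
    - by move=> z /andP[].
  have E2 : q * \sum_u ind (bil u v == 0) = q ^+ 4 * P ^+ 2.
    by rewrite sum_dot1 ?sw_eq0 // expNN.
  have E3 : q * (q * \sum_u ind (bil u v == 0) * ind (bil u v' == 0)) =
    q ^+ 4 * P ^+ 2.
    by rewrite sum_dot2 ?sw_eq0 ?sw_sub // expNN.
  have E4 : \sum_u ind ((bil u v == 0) && (bil u v' != 0)) =
    \sum_u ind (bil u v == 0) - \sum_u ind (bil u v == 0) * ind (bil u v' == 0).
    by rewrite -sumrB; apply: eq_bigr => u _; rewrite indM indN; ring.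
  have E5 : \sum_u ind ((bil u v == 0) && (bil u v' != 0)) * ind (qf u == 0) =
     q ^+ 2 * P ^+ 2 + q ^+ 2 * P - q * P -
       \sum_u ind (qf u == 0) * ind (bil u v == 0) * ind (bil u v' == 0).
    rewrite -(sum_singular_perp vN0 fv) -sumrB; apply: eq_bigr => u _.
    by rewrite indM indN; ring.
  move: E1 E2 E3 E4 E5; set A := \sum_u _ * _; set B := \sum_u ind (_ && _);
  set C := \sum_u ind (bil u v == 0); set C' := \sum_u _ * _;
    set D := \sum_u _ * _ => E1 E2 E3 E4 E5.
  have -> : D = q ^+ 2 * P ^+ 2 + q ^+ 2 * P - q * P - A by rewrite E5; ring.
  apply: (mulfI (q_neq0 F)); apply: (mulfI (q_neq0 F));
    apply: (mulfI (q_neq0 F)).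
  rewrite [ind _]/=.
  have -> : q * (q * (q * (q ^+ 2 * P ^+ 2 + q ^+ 2 * P - q * P - A))) =
    q ^+ 3 * (q ^+ 2 * P ^+ 2 + q ^+ 2 * P - q * P) - q ^+ 2 * (q * A) by ring.
  rewrite E1 E4.
  have -> : q ^+ 2 * (C - C') = q * (q * C) - q * (q * C') by ring.
  by rewrite E2 E3; ring.
apply: (mulfI (q_neq0 F)); rewrite [ind false]/= mulr0 addr0.
have -> : q * (q * P ^+ 2 + q * P - P) =
  q ^+ 2 * P ^+ 2 + q ^+ 2 * P - q * P by ring.
rewrite -(sum_singular_perp vN0 fv).
under eq_bigr do rewrite -indM; under [RHS]eq_bigr do rewrite -indM.
apply: (@sum_ind_fiber _ _ (fun l u => u + l *: v) (fun u =>
  (qf u == 0) && (bil u v == 0)) _ (fun=> bil v v')) => //.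
- by move=> l; apply: addZ_inj.
- move=> l z; rewrite qfD qfZ fv !bilDl !bilZl bilZr bil_refl // !mulr0 !addr0.
  by case: (altP (bil z v =P 0)) => [->|_]; rewrite ?mulr0 ?addr0 ?andbF.
- by move=> l z _; rewrite bilDl bilZl.
Qed.
End Singular.

(** * Tight weights *)

(** A linear form on U vanishes either everywhere or on a q-th part of U. *)
Lemma sum_subspace_perp (F : finFieldType) (N : nat) (U : pred 'rV[F]_(N +
  N)) v :
  (forall l u u', U u -> U u' -> U (u + l *: u')) ->
  #|F|%:Z * \sum_u ind (U u) * ind (bil u v == 0) =
  (\sum_u ind (U u)) * (1 + (#|F|%:Z - 1) * ind [forall u,
    U u ==> (bil u v == 0)]).
Proof.
move=> Uc; case: (boolP [forall u, _]) => [/forallP A|].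
  rewrite [ind true]/= mulr1 addrC subrK.
  rewrite mulrC; congr (_ * _); apply: eq_bigr => u _.
  rewrite -[RHS]mulr1; apply: ind_mull => Uu.
  by have := A u; rewrite Uu /= => ->.
rewrite negb_forall => /existsP[u0]; rewrite negb_imply => /andP[Uu0 b0].
rewrite [ind false]/= mulr0 addr0 mulr1.
have Ush l u : U (u + l *: u0) = U u.
  apply/idP/idP => Uu; last exact: Uc.
  by rewrite -(addrK (l *: u0) u) -scaleNr Uc.
by apply: (@sum_dot_shift _ _ U u0 (sw v) 0 Ush).
Qed.

Section Spectral.
Variables (F : finFieldType) (m : nat).
Notation N := m.+2.
Notation W := 'rV[F]_(N + N).
Notation q := (#|F|%:Z).
Notation P := (q ^+ m).
Variables (x : int) (tau : W -> int).
Hypothesis tau0 : tau 0 = x.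
Hypothesis tauS : forall p, ind (qf p == 0) * tau p = tau p.
Hypothesis tauZ : forall a p, a != 0 -> tau (a *: p) = tau p.

Definition perp_weight (u : W) : int := \sum_v ind (bil u v == 0) * tau v.
Notation D := perp_weight.

Lemma tau_line p : \sum_l tau (l *: p) = x + (q - 1) * tau p.
Proof. by rewrite sum_homogeneous ?tau0 // => l; apply: tauZ. Qed.

Lemma tau_mull p (y z : int) : (qf p = 0 -> y = z) -> tau p * y = tau p * z.
Proof.
move=> E; rewrite -tauS -!mulrA; apply: ind_mull => /eqP /E ->.
by [].
Qed.

Hypothesis tau01 : forall p, p != 0 -> tau p * tau p = tau p.
Hypothesis tau_total : \sum_p tau p = x * (q ^+ 2 * P).
(** Tightness in vector form. The three summands come from the pair (0, 0), the pairs with exactly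
    one zero entry, and the pairs of nonzero vectors; only the last uses the average condition. *)
Hypothesis tau_perp : \sum_u tau u * D u =
  x ^+ 2 + 2 * x * (x * (q ^+ 2 * P - 1)) +
  x * (q ^+ 2 * P - 1) * (x * (q * P - 1) + (q - 1) * (q * P)).

Lemma perp_weight0 : D 0 = x * (q ^+ 2 * P).
Proof.
by rewrite -tau_total; apply: eq_bigr => v _; rewrite bilC bil0r eqxx mul1r.
Qed.

Let N1 := q ^+ 2 * P ^+ 2 + q ^+ 2 * P - q * P.

Lemma sum_perp_weight :
  \sum_u ind (qf u == 0) * D u =
    N1 * (x * (q ^+ 2 * P)) + x * (q ^+ 2 * P ^+ 2 * (q - 1)).
Proof.
rewrite sum_swap_mul.
transitivity (\sum_v (N1 * tau v +
  q ^+ 2 * P ^+ 2 * (q - 1) * (ind (v == 0) * tau v))).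
  apply: eq_bigr => v _.
  transitivity (tau v * \sum_u ind (qf u == 0) * ind (bil u v == 0)).
    by rewrite mulr_sumr; apply: eq_bigr => u _; ring.
  transitivity (tau v * (N1 + q ^+ 2 * P ^+ 2 * (q - 1) * ind (v == 0)));
    last by ring.
  apply: tau_mull => fv; have [->|vN0] := eqVneq v 0; last first.
    by rewrite sum_singular_perp //= /N1; ring.
  under eq_bigr do rewrite bil0r eqxx mulr1.
  by rewrite sum_singular /N1 /=; ring.
by rewrite big_split /= -!mulr_sumr tau_total sum_pick tau0; ring.
Qed.

Lemma sum_perp_weight_sqr :
  \sum_u ind (qf u == 0) * (D u * D u) =
   (q * P ^+ 2 + q * P - P) * (x * (q ^+ 2 * P)) ^+ 2 +
     P * (q - 1) ^+ 2 * (\sum_u tau u * D u)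
   + q * P ^+ 2 * (q - 1) * (x * (x * (q ^+ 2 * P)) +
     (q - 1) * (\sum_v tau v * tau v))
   + x * (N1 * (x * (q ^+ 2 * P)) + q ^+ 2 * P ^+ 2 * (q - 1) * x
     - ((q * P ^+ 2 + q * P - P) * (x * (q ^+ 2 * P)) +
       P * (q - 1) ^+ 2 * (x * (q ^+ 2 * P))
       + q * P ^+ 2 * (q - 1) * (q * x))).
Proof.
(* [sum_singular_perp2] requires v nonzero; [corr] is the actual inner sum at v = 0 minus the value
   that the formula would give there. *)
set t := x * (q ^+ 2 * P); set corr := (N1 * t + _ - _).
transitivity (\sum_v tau v * ((q * P ^+ 2 + q * P - P) * t +
  P * (q - 1) ^+ 2 * D v
   + q * P ^+ 2 * (q - 1) * (x + (q - 1) * tau v) + ind (v == 0) * corr));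
     last first.
  under eq_bigr => v _.
    have -> : tau v * ((q * P ^+ 2 + q * P - P) * t + P * (q - 1) ^+ 2 * D v
       + q * P ^+ 2 * (q - 1) * (x + (q - 1) * tau v) + ind (v == 0) * corr)
      = ((q * P ^+ 2 + q * P - P) * t + q * P ^+ 2 * (q - 1) * x) * tau v +
        P * (q - 1) ^+ 2 * (tau v * D v)
      + q * P ^+ 2 * (q - 1) * (q - 1) * (tau v * tau v) +
        corr * (ind (v == 0) * tau v) by ring.
    over.
  rewrite !big_split /= -!mulr_sumr tau_total -/t sum_pick tau0; ring.
transitivity (\sum_v tau v * \sum_v' tau v' *
   \sum_u ind (qf u == 0) * ind (bil u v == 0) * ind (bil u v' == 0)).
  under eq_bigr do rewrite /D sum_mul_sum mulr_sumr.
  rewrite exchange_big; apply: eq_bigr => v _ /=.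
  under eq_bigr do rewrite mulr_sumr.
  rewrite exchange_big mulr_sumr; apply: eq_bigr => v' _ /=.
  by rewrite !mulr_sumr; apply: eq_bigr => u _; ring.
apply: eq_bigr => v _; apply: tau_mull => fv; have [->|vN0] := eqVneq v 0.
  transitivity (\sum_v' tau v' * (N1 +
    q ^+ 2 * P ^+ 2 * (q - 1) * ind (v' == 0))).
    apply: eq_bigr => v' _; apply: tau_mull => fv'.
    under eq_bigr do rewrite bil0r eqxx mulr1.
    have [->|v'N0] := eqVneq v' 0.
      under eq_bigr do rewrite bil0r eqxx mulr1.
      by rewrite sum_singular /N1 /=; ring.
    by rewrite sum_singular_perp //= /N1; ring.
  rewrite perp_weight0 tau0 /corr /= -/t.
  under eq_bigr => v' _.
    have -> : tau v' * (N1 + q ^+ 2 * P ^+ 2 * (q - 1) * ind (v' == 0)) =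
      N1 * tau v' + q ^+ 2 * P ^+ 2 * (q -
        1) * (ind (v' == 0) * tau v') by ring.
    over.
  rewrite big_split /= -!mulr_sumr tau_total sum_pick tau0 -/t; ring.
rewrite [ind _]/= mul0r addr0 -tau_line -sum_line.
transitivity (\sum_v' tau v' * (q * P ^+ 2 + q * P - P +
  P * (q - 1) ^+ 2 * ind (bil v v' == 0) +
    q * P ^+ 2 * (q - 1) * ind (v' <= v)%MS)).
  by apply: eq_bigr => v' _; apply: tau_mull => fv'; rewrite sum_singular_perp2.
rewrite /t -tau_total /D !mulr_sumr -!big_split /=; apply: eq_bigr => v' _.
rewrite ind_dep //; ring.
Qed.

Theorem tight_perp_weight u : qf u = 0 -> D u = q * P * (x + (q - 1) * tau u).
Proof.
move=> fu.
(* The predicted value is the case where U is spanned by u of |U| tau(U^perp) = q^N tau(U). *)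
pose dlt u := D u - q * P * (x + (q - 1) * tau u).
have tau2 : \sum_v tau v * tau v = x ^+ 2 + x * (q ^+ 2 * P) - x.
  rewrite -tau_total (bigD1 0) //= tau0 [in RHS](bigD1 0) //= tau0.
  rewrite (eq_bigr tau) => [|v /tau01 //]; ring.
have Z : \sum_u ind (qf u == 0) * (dlt u * dlt u) = 0.
  transitivity (\sum_u (ind (qf u == 0) * (D u * D u) -
    2 * q * P * x * (ind (qf u == 0) * D u)
    - 2 * q * P * (q - 1) * (tau u * D u) +
      q ^+ 2 * P ^+ 2 * x ^+ 2 * ind (qf u == 0)
    + 2 * q ^+ 2 * P ^+ 2 * x * (q - 1) * tau u +
      q ^+ 2 * P ^+ 2 * (q - 1) ^+ 2 * (tau u * tau u))).
    apply: eq_bigr => v _; have := tauS v; rewrite /dlt;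
      case: (qf v == 0) => /=.
      by move=> _; ring.
    by rewrite mul0r => <-; ring.
  rewrite !big_split /= !sumrN -!mulr_sumr sum_perp_weight sum_perp_weight_sqr.
  rewrite tau_perp tau2 tau_total sum_singular /N1; ring.
have/eqP := Z; rewrite psumr_eq0 => [/allP/(_ u)|v _]; last first.
  by rewrite mulr_ge0 ?sqr_ge0 // /ind; case: ifP.
rewrite mem_index_enum fu eqxx mul1r mulf_eq0 orbb => /(_ isT)/eqP/eqP.
by rewrite subr_eq0 => /eqP.
Qed.

(** [D] is summed over U in two ways: pointwise by [tight_perp_weight], and after exchanging the
    sums by [sum_subspace_perp]. The result has the shape of a Poisson summation formula. *)
Lemma subspace_perp_weight (U : pred W) :
  (forall l u v, U u -> U v -> U (u + l *: v)) ->
  (forall u, U u -> qf u = 0) ->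
  (\sum_u ind (U u)) * (\sum_v ind [forall u, U u ==> (bil u v == 0)] * tau v) =
  q ^+ 2 * P * \sum_u ind (U u) * tau u.
Proof.
move=> Uc Us.
have E1 : \sum_u ind (U u) * D u =
  q * P * (x * (\sum_u ind (U u)) + (q - 1) * \sum_u ind (U u) * tau u).
  rewrite !mulr_sumr -big_split mulr_sumr /=; apply: eq_bigr => u _.
  rewrite (ind_mull (y := q * P * (x + (q - 1) * tau u))); last first.
    by move=> Uu; rewrite tight_perp_weight ?Us.
  by ring.
have E2 : q * \sum_u ind (U u) * D u =
  \sum_v tau v * ((\sum_u ind (U u)) * (1 + (q - 1) * ind [forall u,
    U u ==> (bil u v == 0)])).
  rewrite sum_swap_mul mulr_sumr; apply: eq_bigr => v _.
  transitivity (tau v * (q * \sum_u ind (U u) * ind (bil u v == 0))).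
    by rewrite !mulr_sumr; apply: eq_bigr => u _; ring.
  by rewrite sum_subspace_perp.
have E3 : \sum_v tau v * ((\sum_u ind (U u)) * (1 + (q - 1) * ind [forall u,
  U u ==> (bil u v == 0)]))
  = (\sum_u ind (U u)) * (x * (q ^+ 2 * P)) + (q - 1) *
   ((\sum_u ind (U u)) * (\sum_v ind [forall u,
     U u ==> (bil u v == 0)] * tau v)).
  rewrite -tau_total !mulr_sumr -big_split /=; apply: eq_bigr => v _; ring.
apply: (mulfI (qB1_neq0 F)).
have := E2; rewrite E3 E1 => H.
apply: (addrI ((\sum_u ind (U u)) * (x * (q ^+ 2 * P)))).
by rewrite -H; ring.
Qed.
End Spectral.

(** * Residues of subspaces of codimension 2 *)

Section Indep.
Variables (F : finFieldType) (d : nat).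
Implicit Types z y : 'rV[F]_d.

Definition indep z1 z2 := (z1 != 0) && ~~ (z2 <= z1)%MS.

Lemma indepP z1 z2 :
  reflect (forall a b, a *: z1 + b *: z2 = 0 -> a = 0 /\ b = 0) (indep z1 z2).
Proof.
apply: (iffP andP) => [[z1N0 zN] a b E|H].
  have b0 : b = 0.
    apply/eqP; apply: contraNT zN => bN0; apply/sub_rVP; exists (- (b^-1 * a)).
    rewrite scaleNr -scalerA; apply/eqP;
      rewrite -addr_eq0 -(inj_eq (scalerI bN0)).
    by rewrite scalerDr !scalerA mulrA divff // mul1r addrC E scaler0.
  split=> //; move: E; rewrite b0 scale0r addr0 => /eqP.
  by rewrite scaler_eq0 (negPf z1N0) orbF => /eqP.
split.
  apply/eqP => z0; have [] := H 1 0; first by rewrite z0 scaler0 scale0r addr0.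
  by move/eqP; rewrite oner_eq0.
apply/sub_rVP => -[a E]; have [] := H a (-1).
  by rewrite E scaleN1r subrr.
by move=> _ /eqP; rewrite oppr_eq0 oner_eq0.
Qed.

Lemma indep_sym z1 z2 : indep z1 z2 = indep z2 z1.
Proof.
by apply/indepP/indepP => H a b; rewrite addrC => /H[].
Qed.

Lemma indep_comb_inj z1 z2 a b a' b' : indep z1 z2 ->
  a *: z1 + b *: z2 = a' *: z1 + b' *: z2 -> a = a' /\ b = b'.
Proof.
move=> /indepP H /eqP; rewrite -subr_eq0 opprD addrACA -!scalerBl => /eqP/H.
by case=> /eqP + /eqP; rewrite !subr_eq0 => /eqP-> /eqP->.
Qed.
End Indep.

Section Model.
Variables (F : finFieldType) (m : nat).
Notation N := m.+2.
Notation vec := 'rV[F]_N.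
Notation W := 'rV[F]_(N + N).
Notation q := (#|F|%:Z).
Notation P := (q ^+ m).
Variables (x w : int) (tau : W -> int).
Hypothesis tau0 : tau 0 = x.
Hypothesis tauS : forall p, ind (qf p == 0) * tau p = tau p.
Hypothesis tauZ : forall a p, a != 0 -> tau (a *: p) = tau p.
Hypothesis tau_sub : forall U : pred W,
  (forall l u v, U u -> U v -> U (u + l *: v)) ->
  (forall u, U u -> qf u = 0) ->
  (\sum_u ind (U u)) * (\sum_v ind [forall u, U u ==> (bil u v == 0)] * tau v) =
  q ^+ 2 * P * \sum_u ind (U u) * tau u.

Notation t2 g z := (tau (row_mx g z)).

Lemma t2Z a g z : a != 0 -> t2 (a *: g) (a *: z) = t2 g z.
Proof. by move=> aN0; rewrite -scale_row_mx tauZ. Qed.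

Lemma t2Z0 a g : a != 0 -> t2 (a *: g) 0 = t2 g 0.
Proof. by move=> aN0; rewrite -(t2Z g 0 aN0) scaler0. Qed.

Lemma t2S g z : ind (dot g z == 0) * t2 g z = t2 g z.
Proof. by rewrite -[RHS]tauS /qf row_mxKl row_mxKr. Qed.

Lemma t200 : t2 0 0 = x. Proof. by rewrite row_mx0. Qed.

(* z1 and z2 span the annihilator of a subspace S of codimension 2 in G.  Column
   z1 of the grid S^perp/S consists of the points over (g,
     z1) with g.z1 = 0: its
   row t is g.z2 = t, and its point on G is the hyperplane g.z1 = 0. *)
Definition gen_weight := \sum_(g : vec) t2 g 0.
Definition hyp_weight (z : vec) := \sum_g ind (dot g z == 0) * t2 g 0.
(** For z nonzero, one representative (g, z) is taken for each point off G of the second generator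
    through the hyperplane g.z = 0 of G. *)
Definition off_weight (z : vec) := \sum_g ind (dot g z == 0) * t2 g z.
Definition cell z1 z2 t := \sum_(g : vec) ind (dot g z1 == 0) * ind (dot g z2
  == t) * t2 g z1.
Definition base_cell z1 z2 := \sum_(g : vec) ind (dot g z1 == 0) * ind (dot g
  z2 == 1) * t2 g 0.
Definition core z1 z2 := \sum_(g : vec) ind (dot g z1 == 0) * ind (dot g z2 ==
  0) * t2 g 0.
(** The q rows other than G are labelled by all t in F, t = 0 included. Column z1 meets row t in
    [cell] and G in [base_cell], so the difference is the row value r_t when G has row value 0. *)
Definition rho z1 z2 t := cell z1 z2 t - base_cell z1 z2.

Lemma bil_row (g z g' z' : vec) : bil (row_mx g z) (row_mx g' z') =
  dot g z' + dot g' z.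
Proof. by rewrite bilE !row_mxKl !row_mxKr. Qed.

(** This is [tau_sub] for the hyperplane g.z1 = 0 of G: the singular vectors of its perp form two
    generators, G and the one behind [off_weight]. *)
Lemma gen_off_weight z1 : z1 != 0 ->
  gen_weight + (q - 1) * off_weight z1 = q * hyp_weight z1.
Proof.
move=> z1N0.
pose U (u : W) := (rsubmx u == 0) && (dot (lsubmx u) z1 == 0).
have U1 : \sum_u ind (U u) = q * P.
  apply: (mulfI (q_neq0 F)); rewrite sum_row_mx exchange_big /=.
  under eq_bigr do under eq_bigr do rewrite /U row_mxKl row_mxKr indM.
  under eq_bigr do rewrite -mulr_sumr.
  by rewrite sum_pick sum_dot1 // expN; ring.
have Ut : \sum_u ind (U u) * tau u = hyp_weight z1.
  rewrite sum_row_mx exchange_big /=.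
  under eq_bigr do under eq_bigr do rewrite /U row_mxKl row_mxKr indM -mulrA.
  under eq_bigr do rewrite -mulr_sumr.
  by rewrite sum_pick.
have Up : \sum_v ind [forall u, U u ==> (bil u v == 0)] * tau v =
    gen_weight + (q - 1) * off_weight z1.
  transitivity (\sum_z (\sum_l ind (z == l *: z1)) * \sum_g t2 g z).
    rewrite sum_row_mx exchange_big /=; apply: eq_bigr => z _.
    rewrite -ind_dep // mulr_sumr; apply: eq_bigr => g _; congr (ind _ * _).
    apply/forallP/idP => [A|/sub_rVP[a ->] u].
      apply: contraT => /exists_perp[u uz1 uz].
      have := A (row_mx u 0); rewrite /U row_mxKl row_mxKr eqxx uz1 ?submx_refl
        // eqxx.
      by rewrite bil_row dot0r addr0 (negPf uz).
    apply/implyP => /andP[/eqP r0 /eqP d0].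
    by rewrite bilE row_mxKl row_mxKr r0 dotZr d0 dot0r mulr0 addr0.
  rewrite sum_line (@sum_const_off0 _ _ (off_weight z1)) ?scale0r //.
  move=> l lN0; rewrite (sum_scale _ lN0).
  by apply: eq_bigr => g _; rewrite t2Z // t2S.
have := @tau_sub U _ _; rewrite U1 Up Ut => H.
apply: (mulfI (q_neq0 F)); apply: (mulfI (expf_neq0 m (q_neq0 F))).
rewrite mulrCA mulrA mulrA H; first by ring.
- move=> l u v /andP[/eqP u1 /eqP u2] /andP[/eqP v1 /eqP v2].
  by rewrite /U !linearD !linearZ /= u1 v1 dotDl dotZl u2 v2 scaler0 mulr0
    !addr0 !eqxx.
- by move=> u /andP[/eqP u1 _]; rewrite /qf u1 dot0r.
Qed.

Lemma hyp_weightE z1 z2 : hyp_weight z1 =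
  core z1 z2 + (q - 1) * base_cell z1 z2.
Proof.
rewrite -(@sum_const_off0 _ (fun l =>
  \sum_g ind (dot g z1 == 0) * ind (dot g z2 == l) * t2 g 0)).
  rewrite exchange_big; apply: eq_bigr => g _ /=.
  transitivity (\sum_l ind (dot g z2 == l) * (ind (dot g z1 == 0) * t2 g 0)).
    by rewrite sum_pickr.
  by apply: eq_bigr => l _; ring.
move=> l lN0; rewrite (sum_scale _ lN0); apply: eq_bigr => g _.
rewrite t2Z0 // !dotZl mulf_eq0 (negPf lN0) /=.
by rewrite -{2}(mulr1 l) (inj_eq (mulfI lN0)).
Qed.

(* The weight of the generator through S that is row t of the grid. *)
Definition row_weight z1 z2 t := \sum_(a : F) \sum_(b : F) \sum_(g : vec)
  ind (dot g z1 == - (b * t)) * ind (dot g z2 == a * t) * t2 g (a *: z1 +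
    b *: z2).

Lemma row_weight_sym z1 z2 t : row_weight z1 z2 t = row_weight z2 z1 (- t).
Proof.
rewrite /row_weight exchange_big /=.
apply: eq_bigr => b _; apply: eq_bigr => a _; apply: eq_bigr => g _.
by rewrite !mulrN opprK [b *: _ + _]addrC; congr (_ * _); apply: mulrC.
Qed.

Lemma sum_comb z1 z2 (Phi : F -> F -> vec -> int) :
  \sum_z \sum_a \sum_b ind (z == a *: z1 + b *: z2) * Phi a b z =
  \sum_a \sum_b Phi a b (a *: z1 + b *: z2).
Proof.
rewrite exchange_big; apply: eq_bigr => a _ /=.
by rewrite exchange_big; apply: eq_bigr => b _ /=; rewrite sum_pick.
Qed.

Lemma sub_col2P (z1 z2 z : vec) :
  reflect (exists a b, z = a *: z1 + b *: z2) (z <= col_mx z1 z2)%MS.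
Proof.
rewrite -addsmxE; apply: (iffP sub_addsmxP) => [[[u v] ->]|[a [b ->]]].
  exists (u 0 0), (v 0 0).
  by rewrite [u in LHS]mx11_scalar [v in LHS]mx11_scalar !mul_scalar_mx.
by exists (a%:M, b%:M); rewrite !mul_scalar_mx.
Qed.

(** The subspace is S extended by a vector (u0, z1) with u0.z1 = 0 and u0.z2 = t. Orthogonality to S
    puts z into the span of z1 and z2; orthogonality to (u0, z1) then reads g.z1 = - b t. By
    independence at most one term of the sum survives. *)
Lemma ind_perp_line z1 z2 t g z : indep z1 z2 ->
  ind [forall u : W, [exists p, [&& rsubmx u == p *: z1, dot (lsubmx u) z1 == 0
      & dot (lsubmx u) z2 == p * t]] ==> (bil u (row_mx g z) == 0)] =
  \sum_a \sum_b ind (z == a *: z1 + b *: z2) * ind (dot g z1 == - (b * t)).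
Proof.
move=> zi; case: (boolP (z <= col_mx z1 z2)%MS) => [/sub_col2P[a [b ->]]|zN].
  rewrite (eq_bigr (fun a' => ind (a == a') * \sum_b' ind (b == b') * ind (dot
    g z1 == - (b' * t)))).
    rewrite sum_pickr sum_pickr; congr ind.
    apply/forallP/eqP => [A|E u].
      have [u0 u01 u02] : exists2 u0, dot u0 z1 = 0 & dot u0 z2 = t.
        have /andP[_ /exists_perp[u u1 u2]] := zi.
        exists ((t / dot u z2) *: u); first by rewrite dotZl (u1 z1)
          ?submx_refl // mulr0.
        by rewrite dotZl divfK.
      have := A (row_mx u0 z1); rewrite !row_mxKl !row_mxKr.
      have -> /= : [exists p, [&& z1 == p *: z1,
        dot u0 z1 == 0 & dot u0 z2 == p * t]].
        by apply/existsP; exists 1; rewrite scale1r mul1r u01 u02 !eqxx.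
      rewrite bil_row dotDr !dotZr u01 u02 mulr0 add0r addrC addr_eq0.
      by move=> /eqP.
    apply/implyP => /existsP[p /and3P[/eqP r /eqP u1 /eqP u2]].
    rewrite bilE row_mxKl row_mxKr r dotDr !dotZr u1 u2 E; apply/eqP; ring.
  move=> a' _; rewrite mulr_sumr; apply: eq_bigr => b' _.
  rewrite [RHS]mulrA; congr (_ * _); rewrite -indM; congr ind;
    apply/eqP/andP => [/(indep_comb_inj zi)|].
    by case=> -> ->; rewrite !eqxx.
  by case=> /eqP-> /eqP->.
rewrite big1 => [|a _]; last first.
  rewrite big1 // => b _; case: eqP => [E|]; last by rewrite mul0r.
  by case/negP: zN; apply/sub_col2P; exists a, b.
case/exists_perp: zN => u uB uz; case: forallP => // A.
have := A (row_mx u 0); rewrite row_mxKl row_mxKr.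
have -> /= : [exists p, [&& 0 == p *: z1, dot u z1 == 0 & dot u z2 == p * t]].
  apply/existsP; exists 0; rewrite scale0r mul0r !uB ?eqxx //.
    by apply/sub_col2P; exists 0, 1; rewrite scale0r scale1r add0r.
  by apply/sub_col2P; exists 1, 0; rewrite scale0r scale1r addr0.
by rewrite bil_row dot0r addr0 (negPf uz).
Qed.

(** Let U be S extended by the grid point in column z1 and row t. The singular vectors of U^perp
    form the column and the row through that point, so [tau_sub] relates the row weight to the cell.
    The right-hand side no longer singles out a column, which is the additivity r_i + c_j. *)
Lemma rho_row_weight z1 z2 t : indep z1 z2 ->
  (q + 1) * (q - 1) * rho z1 z2 t = row_weight z1 z2 t - gen_weight.
Proof.
move=> zi; have /andP[z1N0 z2N] := zi.
pose U (u : W) := [exists p, [&& rsubmx u == p *: z1, dot (lsubmx u) z1 == 0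
      & dot (lsubmx u) z2 == p * t]].
have UE g z : ind (U (row_mx g z)) =
    \sum_p ind (z == p *: z1) * (ind (dot g z1 == 0) * ind (dot g z2 == p * t)).
  rewrite /U row_mxKl row_mxKr; case: existsP => [[p /and3P[/eqP-> -> e2]]|A].
    rewrite (bigD1 p) //= eqxx e2 big1 // => p' p'N;
      rewrite -subr_eq0 -scalerBl.
    by rewrite scaler_eq0 (negPf z1N0) orbF subr_eq0 eq_sym (negPf p'N) mul0r.
  rewrite big1 // => p _; rewrite -!indM /ind; case: ifP => // B.
  by case: A; exists p.
have sumU (Phi : W -> int) : \sum_u ind (U u) * Phi u =
    \sum_p \sum_g ind (dot g z1 == 0) * ind (dot g z2 == p * t) * Phi (row_mx g
      (p *: z1)).
  rewrite sum_row_mx.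
  under eq_bigr do under eq_bigr do rewrite UE mulr_suml.
  rewrite [RHS]exchange_big; apply: eq_bigr => g _ /=.
  rewrite exchange_big; apply: eq_bigr => p _ /=.
  rewrite -[RHS](sum_pick (p *: z1) (fun z =>
    ind (dot g z1 == 0) * ind (dot g z2 == p * t) * Phi (row_mx g z))).
  by apply: eq_bigr => z _; rewrite !mulrA.
have U1 : \sum_u ind (U u) = q * P.
  transitivity (\sum_u ind (U u) * 1); first by apply: eq_bigr => u _;
    rewrite mulr1.
  rewrite sumU; under eq_bigr do under eq_bigr do rewrite mulr1.
  rewrite (eq_bigr (fun=> P)) => [|p _].
    by rewrite sumr_const -mulr_natl natz.
  by do 2! apply: (mulfI (q_neq0 F)); rewrite sum_dot2 // expN; ring.
pose lw := core z1 z2 + (q - 1) * cell z1 z2 t.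
have lwE : \sum_p \sum_g ind (dot g z1 == 0) * ind (dot g z2 == p * t) * t2 g
  (p *: z1) = lw.
  rewrite (@sum_const_off0 _ _ (cell z1 z2 t)) ?mul0r ?scale0r // => p pN0.
  rewrite (sum_scale _ pN0); apply: eq_bigr => g _.
  by rewrite t2Z // !dotZl mulf_eq0 (negPf pN0) /= (inj_eq (mulfI pN0)).
have Ut : \sum_u ind (U u) * tau u = lw by rewrite sumU.
have Up : \sum_v ind [forall u, U u ==> (bil u v == 0)] * tau v =
    hyp_weight z1 + (q - 1) * off_weight z1 + row_weight z1 z2 t - lw.
  transitivity (\sum_a \sum_b \sum_g ind (dot g z1 == -
    (b * t)) * t2 g (a *: z1 + b *: z2)).
    rewrite -(sum_comb z1 z2 (fun a b z =>
      \sum_g ind (dot g z1 == - (b * t)) * t2 g z)).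
    rewrite sum_row_mx exchange_big /=; apply: eq_bigr => z _.
    under eq_bigr => g _.
      rewrite ind_perp_line // mulr_suml.
      under eq_bigr do rewrite mulr_suml.
      over.
    rewrite exchange_big; apply: eq_bigr => a _ /=.
    rewrite exchange_big; apply: eq_bigr => b _ /=.
    by rewrite mulr_sumr; apply: eq_bigr => g _; rewrite mulrA.
  have -> : hyp_weight z1 + (q - 1) * off_weight z1 =
      \sum_a \sum_g ind (dot g z1 == 0) * t2 g (a *: z1).
    rewrite (@sum_const_off0 _ _ (off_weight z1)) ?scale0r // => a aN0.
    rewrite (sum_scale _ aN0); apply: eq_bigr => g _.
    by rewrite t2Z // dotZl mulf_eq0 (negPf aN0).
  rewrite -lwE /row_weight -big_split -sumrB /=; apply: eq_bigr => a _.
  rewrite (bigD1 0) //= [X in _ =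
    _ + X - _](bigD1 0) //= !scale0r !addr0 !mul0r !oppr0.
  rewrite -addrA; congr (_ + _); rewrite addrAC subrr add0r.
  (* For b nonzero, singularity of (g, a z1 + b z2) and g.z1 = - b t force g.z2 = a t, so these
     terms belong to row t; the terms with b = 0 formed the column. *)
  apply: eq_bigr => b bN0; apply: eq_bigr => g _.
  rewrite -mulrA; apply: ind_mull => /eqP E; rewrite -[LHS]t2S;
    congr (ind _ * _).
  rewrite dotDr !dotZr E.
  have -> : a * - (b * t) + b * dot g z2 = b * (dot g z2 - a * t) by ring.
  by rewrite mulf_eq0 (negPf bN0) subr_eq0.
have H : q * P * (hyp_weight z1 + (q - 1) * off_weight z1 +
  row_weight z1 z2 t - lw) = q ^+ 2 * P * lw.
  rewrite -U1 -Up -Ut; apply: tau_sub.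
  - move=> l u v /existsP[p1 /and3P[/eqP u1 /eqP u2 /eqP u3]] /existsP[p2
    /and3P[/eqP v1 /eqP v2 /eqP v3]].
    apply/existsP; exists (p1 + l * p2).
    rewrite !linearD !linearZ /= u1 v1 !dotDl !dotZl u2 u3 v2 v3 scalerDl
      scalerA.
    by rewrite mulr0 addr0 mulrDl mulrA !eqxx.
  - by move=> u /existsP[p /and3P[/eqP u1 /eqP u2 _]];
    rewrite /qf u1 dotZr u2 mulr0.
have H' : hyp_weight z1 + (q - 1) * off_weight z1 + row_weight z1 z2 t - lw =
  q * lw.
  apply: (mulfI (q_neq0 F)); apply: (mulfI (expf_neq0 m (q_neq0 F))).
  by rewrite mulrCA mulrA H; ring.
have G := gen_off_weight z1N0.
have E := hyp_weightE z1 z2.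
rewrite /rho.
have -> : (q + 1) * (q - 1) * (cell z1 z2 t - base_cell z1 z2) =
  q * lw + lw - (q + 1) * (core z1 z2 +
    (q - 1) * base_cell z1 z2) by rewrite /lw; ring.
rewrite -E -H'.
have -> : gen_weight = q * hyp_weight z1 - (q -
  1) * off_weight z1 by rewrite -G; ring.
by ring.
Qed.

Lemma rho_swap z1 z2 t : indep z1 z2 -> rho z1 z2 t = rho z2 z1 (- t).
Proof.
move=> zi; apply: (mulfI (mulf_neq0 (qD1_neq0 F) (qB1_neq0 F))).
by rewrite !rho_row_weight 1?[in RHS]row_weight_sym ?opprK // indep_sym.
Qed.
End Model.

(** * Invariance and exact summation *)

Section SpanSum.
Variables (F : finFieldType) (d : nat).
Notation vec := 'rV[F]_d.
Notation q := (#|F|%:Z).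

Definition span2 (p : vec * vec) : {set vec} :=
  [set ab.1 *: p.1 + ab.2 *: p.2 | ab : F * F].

Lemma span2P p y : reflect (exists a b,
  y = a *: p.1 + b *: p.2) (y \in span2 p).
Proof.
apply: (iffP imsetP) => [[[a b] _ ->]|[a [b ->]]]; first by exists a, b.
by exists (a, b).
Qed.

Lemma span2_comb p y1 y2 a b : y1 \in span2 p -> y2 \in span2 p ->
  a *: y1 + b *: y2 \in span2 p.
Proof.
move=> /span2P[a1 [b1 ->]] /span2P[a2 [b2 ->]]; apply/span2P.
exists (a * a1 + b * a2), (a * b1 + b * b2).
by rewrite !scalerDr !scalerDl !scalerA addrACA.
Qed.

Lemma card_span2 p : indep p.1 p.2 -> #|span2 p| = (#|F| ^ 2)%N.
Proof.
move=> pi; rewrite card_imset ?card_prod // => -[a b] [a' b'] /=.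
by move=> /(indep_comb_inj pi)[-> ->].
Qed.

Lemma span2_eq p y : indep p.1 p.2 -> indep y.1 y.2 ->
  (span2 y == span2 p) = (y.1 \in span2 p) && (y.2 \in span2 p).
Proof.
move=> pi yi; apply/eqP/andP => [<-|[y1 y2]].
  by split; apply/span2P; [exists 1, 0|exists 0, 1];
    rewrite scale1r scale0r ?addr0 ?add0r.
apply/eqP; rewrite eqEcard !card_span2 // leqnn andbT.
by apply/subsetP => _ /span2P[a [b ->]]; apply: span2_comb.
Qed.

Lemma sum_in (Y : {set vec}) : \sum_y ind (y \in Y) = #|Y|%:Z.
Proof.
rewrite -[RHS]natz -sumr_const [RHS]big_mkcond /=.
by apply: eq_bigr => y _; case: (y \in Y).
Qed.

Lemma sum_indep_span2 p : indep p.1 p.2 ->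
  \sum_y1 \sum_y2 ind (indep y1 y2) * ind (span2 (y1, y2) == span2 p) =
  (q ^+ 2 - 1) * (q ^+ 2 - q).
Proof.
move=> pi.
have E2 : \sum_y ind (y \in span2 p) = q ^+ 2.
  by rewrite sum_in card_span2 // -[LHS]natz natrX natz.
transitivity (\sum_y1 ind (y1 != 0) * (ind (y1 \in span2 p) * (q ^+ 2 - q))).
  apply: eq_bigr => y1 _.
  transitivity (ind (y1 != 0) * (ind (y1 \in span2 p) *
      \sum_y2 (ind (y2 \in span2 p) -
        ind (y2 <= y1)%MS * ind (y2 \in span2 p)))).
    rewrite !mulr_sumr; apply: eq_bigr => y2 _.
    rewrite (ind_mull (y := ind (y1 \in span2 p) * ind (y2 \in span2 p)));
      last first.
      by move=> yi; rewrite (span2_eq (y := (y1, y2))) // indM.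
    by rewrite /indep indM indN [ind (~~ (_ <= _)%MS)]indN; ring.
  apply: ind_mull => y1N0; apply: ind_mull => y1p; rewrite sumrB E2;
    congr (_ - _).
  under eq_bigr do rewrite ind_dep //.
  rewrite sum_line (eq_bigr (fun=> 1)) ?sum_one // => l _.
  by have := span2_comb l 0 y1p y1p; rewrite scale0r addr0 => ->.
rewrite sum_indD0 -mulr_suml E2 (_ : 0 \in span2 p) ?mul1r; first by ring.
by apply/span2P; exists 0, 0; rewrite !scale0r addr0.
Qed.

(** Ordered bases are grouped by their span; each plane has |GL_2(q)| of them. *)
Lemma dvd_sum_indep (k : vec -> vec -> int) :
  (forall z1 z2 y1 y2, indep z1 z2 -> indep y1 y2 ->
     y1 \in span2 (z1, z2) -> y2 \in span2 (z1, z2) -> k y1 y2 = k z1 z2) ->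
  exists B, \sum_z1 \sum_z2 ind (indep z1 z2) * k z1 z2 =
    (q ^+ 2 - 1) * (q ^+ 2 - q) * B.
Proof.
move=> kE.
(* The value of k on some basis of Y. The default 0 belongs to sets that are not planes, which
   contribute no basis. *)
pose b Y := if [pick p | indep p.1 p.2 && (span2 p == Y)] is Some p then k p.1
  p.2 else 0.
exists (\sum_Y b Y); rewrite mulr_sumr.
transitivity (\sum_Y \sum_z1 \sum_z2 ind (span2 (z1,
  z2) == Y) * (ind (indep z1 z2) * k z1 z2)).
  rewrite [RHS]exchange_big; apply: eq_bigr => z1 _ /=.
  by rewrite [RHS]exchange_big; apply: eq_bigr => z2 _ /=; rewrite sum_pickr.
apply: eq_bigr => Y _; rewrite /b; case: pickP => [p /andP[pi /eqP <-]|pN];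
  last first.
  rewrite mulr0 big1 // => z1 _; rewrite big1 // => z2 _; rewrite mulrA -indM.
  by have := pN (z1, z2); rewrite andbC /= => ->; rewrite mul0r.
rewrite -(sum_indep_span2 pi) mulr_suml; apply: eq_bigr => z1 _.
rewrite mulr_suml; apply: eq_bigr => z2 _; rewrite mulrCA -mulrA.
apply: ind_mull => zi; apply: ind_mull.
rewrite (span2_eq (y := (z1, z2))) // => /andP[z1p z2p].
by apply: kE; rewrite -?surjective_pairing.
Qed.
End SpanSum.

(** Needed on all integers, since [rho] can be negative. *)
Definition choose2 (r : int) : int := ((r * (r - 1)) %/ 2)%Z.

Lemma choose2E r : 2 * choose2 r = r * (r - 1).
Proof.
rewrite /choose2 mulrC divzK //.
have [k [->|->]] : exists k, r = 2 * k \/ r = 2 * k + 1.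
  by exists (r %/ 2)%Z; lia.
- by rewrite -mulrA dvdz_mulr.
- by rewrite addrK mulrCA dvdz_mulr.
Qed.

(** * Independence of k(S) from the basis *)

Section Invariant.
Variables (F : finFieldType) (m : nat).
Notation N := m.+2.
Notation vec := 'rV[F]_N.
Notation W := 'rV[F]_(N + N).
Notation q := (#|F|%:Z).
Notation P := (q ^+ m).
Variables (x w : int) (tau : W -> int).
Hypothesis tau0 : tau 0 = x.
Hypothesis tauS : forall p, ind (qf p == 0) * tau p = tau p.
Hypothesis tauZ : forall a p, a != 0 -> tau (a *: p) = tau p.
Hypothesis tau_sub : forall U : pred W,
  (forall l u v, U u -> U v -> U (u + l *: v)) ->
  (forall u, U u -> qf u = 0) ->
  (\sum_u ind (U u)) * (\sum_v ind [forall u, U u ==> (bil u v == 0)] * tau v) =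
  q ^+ 2 * P * \sum_u ind (U u) * tau u.
Hypothesis tau01 : forall p, p != 0 -> tau p * tau p = tau p.
Hypothesis tau_gen : \sum_(g : vec) tau (row_mx g 0) = x + (q - 1) * w.
Notation t2 g z := (tau (row_mx g z)).

Definition rho_bin (z1 z2 : vec) := \sum_t choose2 (rho tau z1 z2 t).

Lemma rho_bin_swap z1 z2 : indep z1 z2 -> rho_bin z1 z2 = rho_bin z2 z1.
Proof.
move=> zi; rewrite /rho_bin [RHS](reindex_inj oppr_inj) /=.
by apply: eq_bigr => t _; rewrite (rho_swap tauS tauZ tau_sub).
Qed.

(** With z1 fixed, the change of z2 only relabels row t as row a t; the base cell is preserved
    because tau is homogeneous. *)
Lemma rho_bin_comb z1 z2 a b : a != 0 ->
  rho_bin z1 (a *: z2 + b *: z1) = rho_bin z1 z2.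
Proof.
move=> aN0; rewrite /rho_bin (reindex_inj (mulfI aN0)) /=.
have E g : dot g z1 = 0 -> dot g (a *: z2 + b *: z1) = a * dot g z2.
  by move=> g0; rewrite dotDr !dotZr g0 mulr0 addr0.
apply: eq_bigr => t _; congr (choose2 (_ - _)).
  apply: eq_bigr => g _; rewrite -!mulrA; apply: ind_mull => /eqP /E ->.
  by rewrite (inj_eq (mulfI aN0)).
rewrite /base_cell [RHS](sum_scale _ aN0); apply: eq_bigr => g _.
rewrite (t2Z0 tauZ) // !dotZl mulf_eq0 (negPf aN0) /= -!mulrA.
by apply: ind_mull => /eqP /E ->.
Qed.

(** The swap and the changes of basis that fix z1 connect all bases: if y1 has a z2-component the
    path goes through (z1, y1), otherwise y2 has one and it goes through (z1, y2). *)
Lemma rho_bin_span z1 z2 y1 y2 : indep z1 z2 -> indep y1 y2 ->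
  y1 \in span2 (z1, z2) -> y2 \in span2 (z1,
    z2) -> rho_bin y1 y2 = rho_bin z1 z2.
Proof.
move=> zi yi /span2P[a [b /= E1]] /span2P[c [d /= E2]].
have /indepP zI := zi; have /indepP yI := yi.
have [b0|bN0] := eqVneq b 0.
  move: E1; rewrite b0 scale0r addr0 => E1.
  have aN0 : a != 0.
    by apply: contraTneq yi => a0; rewrite E1 a0 scale0r /indep eqxx.
  have dN0 : d != 0.
    apply: contraTneq yi => d0; rewrite /indep negb_and !negbK; apply/orP;
      right.
    by apply/sub_rVP; exists (c / a);
      rewrite E1 E2 d0 scale0r addr0 scalerA divfK.
  rewrite rho_bin_swap // -(rho_bin_comb z1 z2 c dN0) addrC -E2.
  have z1y2 : indep y2 z1.
    apply/indepP => u v E; have [] := yI (v / a) u; last first.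
      by move=> /eqP; rewrite mulf_eq0 invr_eq0 (negPf aN0) orbF => /eqP-> ->.
    by rewrite E1 scalerA divfK // addrC.
  by rewrite [RHS]rho_bin_swap 1?indep_sym // -[RHS](rho_bin_comb y2 z1 0 aN0)
    scale0r addr0 -E1.
have z1y1 : indep z1 y1.
  apply/indepP => u v; rewrite E1 scalerDr addrA !scalerA -scalerDl =>
    /zI[u0 /eqP].
  rewrite mulf_eq0 (negPf bN0) orbF => /eqP v0; move: u0.
  by rewrite v0 mul0r addr0.
rewrite -(rho_bin_comb z1 z2 a bN0) addrC -E1 [RHS]rho_bin_swap //.
have E3 : y2 = (c - d / b * a) *: z1 + (d / b) *: y1.
  rewrite E1 scalerDr scalerA addrA -scalerDl subrK scalerA divfK //.
rewrite [in LHS]E3 rho_bin_comb //.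
apply: contraTneq yi => e0; rewrite /indep negb_and !negbK; apply/orP; right.
by apply/sub_rVP; exists (d / b); rewrite E3 e0 scale0r add0r.
Qed.

Lemma dvd_sum_rho_bin : exists B,
  \sum_z1 \sum_z2 ind (indep z1 z2) * rho_bin z1 z2 =
    (q ^+ 2 - 1) * (q ^+ 2 - q) * B.
Proof. exact: dvd_sum_indep rho_bin_span. Qed.

(** * Exact sums over ordered bases *)

Notation K := (off_weight tau).
Notation H := (hyp_weight tau).
Notation c := (base_cell tau).

Lemma sum_cell z1 z2 : \sum_t cell tau z1 z2 t = K z1.
Proof.
rewrite exchange_big; apply: eq_bigr => g _ /=.
rewrite -[RHS](sum_pickr (dot g z2) (fun=> ind (dot g z1 == 0) * t2 g z1)).
by apply: eq_bigr => t _; ring.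
Qed.

Lemma rho_binE z1 z2 : 2 * rho_bin z1 z2 =
  \sum_t cell tau z1 z2 t * cell tau z1 z2 t - 2 * c z1 z2 * K z1
  + q * (c z1 z2 * c z1 z2) - K z1 + q * c z1 z2.
Proof.
rewrite /rho_bin mulr_sumr.
have E (y : int) : q * y = \sum_(t : F) y by rewrite sumr_const -mulr_natl natz.
rewrite !E -(sum_cell z1 z2) mulr_sumr -sumrB -big_split -sumrB -big_split /=.
by apply: eq_bigr => t _; rewrite choose2E /rho; ring.
Qed.

Lemma sum_dotP (z : vec) a : z != 0 -> \sum_g ind (dot g z == a) = q * P.
Proof. by move=> zN0; apply: (mulfI (q_neq0 F)); rewrite sum_dot1 // expN;
  ring. Qed.

Lemma row_mx_neq0 (g z : vec) : z != 0 -> row_mx g z != 0.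
Proof.
apply: contraNneq => E; apply/eqP.
by have := f_equal rsubmx E; rewrite row_mxKr linear0.
Qed.

(** The squares count, with weights, the pairs (g, g') with (g - g').z2 = 0. A nonzero difference
    admits q P vectors z2, the zero difference all q^2 P. *)
Lemma sum_cell_sqr z1 : z1 != 0 ->
  \sum_z2 \sum_t cell tau z1 z2 t * cell tau z1 z2 t =
  q * P * (K z1 * K z1) + (q ^+ 2 * P - q * P) * K z1.
Proof.
move=> z1N0; pose a g := ind (dot g z1 == 0) * t2 g z1.
transitivity (\sum_g \sum_g' a g * a g' * \sum_z2 ind (dot z2 (g - g') == 0)).
  transitivity (\sum_z2 \sum_g \sum_g' a g * a g' * ind (dot z2 (g -
    g') == 0)); last first.
    rewrite exchange_big; apply: eq_bigr => g _ /=.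
    by rewrite exchange_big; apply: eq_bigr => g' _ /=; rewrite mulr_sumr.
  apply: eq_bigr => z2 _.
  transitivity (\sum_t \sum_g \sum_g' ind (dot g z2 == t) * (a g * a g' * ind
    (dot g' z2 == t))).
    apply: eq_bigr => t _; rewrite sum_mul_sum.
    by apply: eq_bigr => g _; apply: eq_bigr => g' _; rewrite /a; ring.
  rewrite exchange_big; apply: eq_bigr => g _ /=.
  rewrite exchange_big; apply: eq_bigr => g' _ /=; rewrite sum_pickr.
  congr (_ * ind _); rewrite -scaleN1r dotDr dotZr mulN1r subr_eq0 !(dotC z2).
  by rewrite eq_sym.
transitivity (\sum_g \sum_g' (q * P * (a g * a g') +
  (q ^+ 2 * P - q * P) * (ind (g == g') * (a g * a g')))).
  apply: eq_bigr => g _; apply: eq_bigr => g' _.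
  have [->|gN] := eqVneq g g'.
    rewrite subrr; under eq_bigr do rewrite dot0r eqxx.
    by rewrite sum_row1 expN /=; ring.
  by rewrite sum_dotP ?subr_eq0 //=; ring.
under eq_bigr do rewrite big_split /= -!mulr_sumr sum_pickr.
rewrite big_split /= -!mulr_sumr -mulr_suml; congr (_ + _ * _).
apply: eq_bigr => g _; rewrite /a; case: (_ == 0); rewrite ?mul0r //.
by rewrite !mul1r tau01 // row_mx_neq0.
Qed.

(** Without the zero vector and its value x, the weights are 0 or 1 and equal their squares. *)
Definition hyp_weight_nz (z : vec) := H z - x.
Notation h := hyp_weight_nz.

Lemma hyp_weight_nzE z : h z =
  \sum_g ind (g != 0) * (ind (dot g z == 0) * t2 g 0).
Proof. by rewrite sum_indD0 dot0l eqxx mul1r (t200 tau0). Qed.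

Lemma base_cellE z1 z2 :
  c z1 z2 = \sum_g ind (g != 0) * (ind (dot g z1 == 0) * t2 g 0) * ind (dot g
    z2 == 1).
Proof.
apply: eq_bigr => g _; have [->|_] := eqVneq g 0; rewrite /=; last by ring.
by rewrite !dot0l eq_sym oner_eq0 /=; ring.
Qed.

Lemma sum_base_cell z1 : \sum_z2 c z1 z2 = q * P * h z1.
Proof.
under eq_bigr do rewrite base_cellE.
rewrite exchange_big hyp_weight_nzE mulr_sumr; apply: eq_bigr => g _ /=.
rewrite -mulr_sumr [RHS]mulrC -!mulrA; apply: ind_mull => gN0.
by under eq_bigr do rewrite dotC; rewrite sum_dotP.
Qed.

Lemma row_mxl_neq0 (g : vec) : g != 0 -> row_mx g (0 : vec) != 0.
Proof.
apply: contraNneq => E; apply/eqP.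
by have := f_equal lsubmx E; rewrite row_mxKl linear0.
Qed.

(** Independent vectors leave P solutions and equal ones q P; distinct proportional ones leave none,
    since the two equations contradict each other. *)
Lemma sum_dot_pair (g g' : vec) : g != 0 -> g' != 0 ->
  \sum_z ind (dot g z == 1) * ind (dot g' z == 1) =
  P + q * P * ind (g' == g) - P * ind (g' <= g)%MS.
Proof.
move=> gN0 g'N0; under eq_bigr do rewrite (dotC g) (dotC g').
have [/sub_rVP[a Ea]|gN] := boolP (g' <= g)%MS; last first.
  rewrite (negPf (contraNneq _ gN)) => [|->]; last exact: submx_refl.
  by do 2! apply: (mulfI (q_neq0 F)); rewrite sum_dot2 // expN /=; ring.
rewrite Ea; have [->|aN1] := eqVneq a 1.
  rewrite scale1r eqxx; under eq_bigr do rewrite -indM andbb.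
  by rewrite sum_dotP //=; ring.
rewrite big1 => [|z _].
  rewrite (negPf (contraNneq _ aN1)) /=; first by ring.
  move=> /eqP; rewrite -subr_eq0 -{2}(scale1r g) -scalerBl scaler_eq0 (negPf
    gN0) orbF.
  by rewrite subr_eq0.
rewrite -indM dotZr; case: eqP => //= ->.
by rewrite mulr1 (negPf aN1).
Qed.

Lemma sum_base_cell_sqr z1 : \sum_z2 c z1 z2 * c z1 z2 = P * h z1 * (h z1 + 1).
Proof.
pose a g := ind (g != 0) * (ind (dot g z1 == 0) * t2 g 0).
have aE : h z1 = \sum_g a g by rewrite hyp_weight_nzE.
transitivity (\sum_g \sum_g' a g * a g' * \sum_z2 ind (dot g z2 == 1) * ind
  (dot g' z2 == 1)).
  under eq_bigr do rewrite base_cellE sum_mul_sum.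
  rewrite exchange_big; apply: eq_bigr => g _ /=.
  rewrite exchange_big; apply: eq_bigr => g' _ /=.
  by rewrite mulr_sumr; apply: eq_bigr => z2 _; rewrite /a; ring.
transitivity (\sum_g a g * (P * h z1 + q * P * a g - P * ((q - 1) * a g)));
  last first.
  have -> : P * h z1 * (h z1 + 1) =
    \sum_g (P * h z1 + P) * a g by rewrite -mulr_sumr -aE; ring.
  apply: eq_bigr => g _; have : a g * a g = a g.
    rewrite /a; have [->|gN0] := eqVneq g 0; rewrite ?mul0r //.
    case: (_ == 0); rewrite ?mul0r ?mulr0 //.
    by rewrite !mul1r tau01 // row_mxl_neq0.
  move=> aa; transitivity (P * h z1 * a g + P * (a g * a g)); first by ring.
  by rewrite aa; ring.
apply: eq_bigr => g _; rewrite /a -/(a g).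
under eq_bigr do rewrite -mulrA; rewrite -mulr_sumr.
rewrite -![ind (g != 0) * _ * _]mulrA; apply: ind_mull => gN0; congr (_ * _).
transitivity (\sum_g' a g' * (P +
  q * P * ind (g' == g) - P * ind (g' <= g)%MS)).
  apply: eq_bigr => g' _; rewrite /a -![ind (g' != 0) * _ * _]mulrA;
    apply: ind_mull => g'N0.
  by rewrite sum_dot_pair.
transitivity (\sum_g' (P * a g' +
  q * P * (ind (g' == g) * a g') - P * ((\sum_l ind (g' == l *: g)) * a g'))).
  by apply: eq_bigr => g' _; rewrite ind_dep //; ring.
rewrite sumrB big_split /= -!mulr_sumr sum_pick sum_line -aE.
rewrite sum_homogeneous; first by rewrite {2}/a eqxx mul0r add0r /a.
move=> l lN0; rewrite /a scaler_eq0 (negPf lN0) dotZl mulf_eq0 (negPf lN0) /=.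
by rewrite (t2Z0 tauZ).
Qed.

(** Used to remove the dependent pairs from the sum over all z2: for them the whole column weight
    sits at t = 0 and the base cell is empty. *)
Lemma cell_dep z1 a : c z1 (a *: z1) = 0 /\
  \sum_t cell tau z1 (a *: z1) t * cell tau z1 (a *: z1) t = K z1 * K z1.
Proof.
have E t : cell tau z1 (a *: z1) t = ind (t == 0) * K z1.
  rewrite mulr_sumr; apply: eq_bigr => g _.
  rewrite mulrCA -mulrA; apply: ind_mull => /eqP g0.
  by rewrite dotZr g0 mulr0 eq_sym.
split.
  rewrite /base_cell big1 // => g _; rewrite dotZr;
    have [->|] := eqVneq (dot g z1) 0.
    by rewrite mulr0 eq_sym oner_eq0 mulr0 mul0r.
  by rewrite !mul0r.
under eq_bigr do rewrite E mulrACA -indM andbb.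
by rewrite sum_pick.
Qed.

Lemma sum_rho_bin z1 : z1 != 0 ->
  2 * \sum_z2 ind (indep z1 z2) * rho_bin z1 z2 =
  q * P * (K z1 * K z1) + (q ^+ 2 * P - q * P) * K z1 -
    2 * K z1 * (q * P * h z1)
  + q * (P * h z1 * (h z1 + 1)) - q ^+ 2 * P * K z1 + q * (q * P * h z1)
  - q * (K z1 * K z1 - K z1).
Proof.
move=> z1N0.
have Edep : \sum_z2 ind (z2 <= z1)%MS * (2 * rho_bin z1 z2) =
  q * (K z1 * K z1 - K z1).
  under eq_bigr do rewrite ind_dep //.
  rewrite sum_line (eq_bigr (fun=> K z1 * K z1 - K z1)) => [|l _].
    by rewrite sumr_const -mulr_natl natz.
  by rewrite rho_binE; have [-> ->] := cell_dep z1 l; ring.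
have Eall : \sum_z2 2 * rho_bin z1 z2 =
  q * P * (K z1 * K z1) + (q ^+ 2 * P - q * P) * K z1 -
    2 * K z1 * (q * P * h z1)
  + q * (P * h z1 * (h z1 + 1)) - q ^+ 2 * P * K z1 + q * (q * P * h z1).
  under eq_bigr do rewrite rho_binE.
  rewrite -sum_cell_sqr // -sum_base_cell_sqr -sum_base_cell -expN -(sum_row1 F
    N).
  rewrite !big_split /= !sumrN -!mulr_sumr !mulr_suml;
    congr (_ - _ + _ - _ + _).
    by rewrite mulr_sumr; apply: eq_bigr => z2 _; ring.
  by apply: eq_bigr => z2 _; rewrite mul1r.
rewrite -Edep -Eall mulr_sumr -sumrB; apply: eq_bigr => z2 _.
by rewrite /indep z1N0 /= indN; ring.
Qed.

Lemma sum_hyp_weight_nz : \sum_z h z = q * P * ((q - 1) * w).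
Proof.
transitivity (\sum_g ind (g != 0) * (q * P * t2 g 0)).
  under eq_bigr do rewrite hyp_weight_nzE.
  rewrite exchange_big; apply: eq_bigr => g _ /=; rewrite -mulr_sumr.
  apply: ind_mull => gN0; rewrite -mulr_suml; congr (_ * _).
  by under eq_bigr do rewrite dotC; rewrite sum_dotP.
by rewrite sum_indD0 -mulr_sumr tau_gen (t200 tau0); ring.
Qed.

Lemma sum_hyp_weight_nz_sqr :
  \sum_z h z * h z = P * (q - 1) ^+ 2 * w ^+ 2 + P * (q - 1) ^+ 3 * w.
Proof.
pose a (g : vec) := ind (g != 0) * t2 g 0.
have aE : \sum_g a g = (q - 1) * w by rewrite sum_indD0 tau_gen (t200 tau0);
  ring.
transitivity (\sum_g a g * \sum_g' a g' * \sum_z ind (dot g z == 0) * ind (dot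
  g' z == 0)).
  under eq_bigr do rewrite hyp_weight_nzE sum_mul_sum.
  rewrite exchange_big; apply: eq_bigr => g _ /=.
  rewrite exchange_big mulr_sumr; apply: eq_bigr => g' _ /=.
  by rewrite !mulr_sumr; apply: eq_bigr => z2 _; rewrite /a; ring.
have aZ g : \sum_l a (l *: g) = (q - 1) * a g.
  rewrite sum_homogeneous; first by rewrite {1}/a eqxx mul0r add0r.
  move=> l lN0; rewrite /a scaler_eq0 (negPf lN0) /=.
  by rewrite (t2Z0 tauZ).
transitivity (\sum_g a g * (P * ((q - 1) * w) + (q * P - P) * ((q - 1) * a g))).
  apply: eq_bigr => g _; rewrite /a -/(a g) -!mulrA; apply: ind_mull => gN0;
    congr (_ * _).
  transitivity (\sum_g' a g' * (P + (q * P - P) * ind (g' <= g)%MS)).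
    apply: eq_bigr => g' _; congr (_ * _);
      under eq_bigr do rewrite (dotC g) (dotC g').
    have [/sub_rVP[b ->]|gN] := boolP (g' <= g)%MS; last first.
      by do 2! apply: (mulfI (q_neq0 F)); rewrite sum_dot2 // expN /=; ring.
    rewrite /= mulr1 addrC subrK -(sum_dotP 0 gN0); apply: eq_bigr => z _.
    by rewrite dotZr -[RHS]mulr1; apply: ind_mull => /eqP->; rewrite mulr0 eqxx.
  rewrite -aE -/(a g) -aZ -sum_line !mulr_sumr -big_split;
    apply: eq_bigr => g' _ /=.
  by rewrite ind_dep //; ring.
transitivity (\sum_g (P * ((q - 1) * w) + (q * P - P) * (q - 1)) * a g).
  apply: eq_bigr => g _.
  have aa : a g * a g = a g.
    rewrite /a; have [->|gN0] := eqVneq g 0; rewrite ?mul0r //.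
    by rewrite !mul1r tau01 // row_mxl_neq0.
  transitivity (P * ((q - 1) * w) * a g + (q * P - P) * (q - 1) * (a g * a g));
    first by ring.
  by rewrite aa; ring.
by rewrite -mulr_sumr aE; ring.
Qed.

(** For z nonzero, the number of points of T in the hyperplane g.z = 0 of G, written without a
    division by q - 1. *)
Definition slope (z : vec) := K z - (x - w) - h z.

Lemma slopeE z : z != 0 -> h z = (q - 1) * slope z /\ K z = x - w + q * slope z.
Proof.
move=> zN0; have := gen_off_weight tauS tauZ tau_sub zN0.
rewrite /gen_weight tau_gen -[H z](subrK x) -/(h z) => E.
have hE : h z = (q - 1) * slope z.
  have -> : (q - 1) * slope z =
    x + (q - 1) * w + (q - 1) * K z - q * x - (q - 1) * h z by rewrite /slope;
      ring.
  by rewrite E; ring.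
split=> //; rewrite -[LHS](_ : slope z + (x - w) + h z = _);
  last by rewrite /slope; ring.
by rewrite hE; ring.
Qed.

Lemma hyp_weight_nz0 : h 0 = (q - 1) * w.
Proof.
have -> : h 0 = gen_weight tau - x.
  by congr (_ - _); apply: eq_bigr => g _; rewrite dot0r eqxx mul1r.
by rewrite /gen_weight tau_gen; ring.
Qed.

Lemma sum_slope : \sum_(z | z != 0) slope z = w * (q * P - 1).
Proof.
apply: (mulfI (qB1_neq0 F)); rewrite mulr_sumr.
rewrite (eq_bigr h) => [|z /slopeE[-> _] //].
have := sum_hyp_weight_nz; rewrite (bigD1 0) //= hyp_weight_nz0 => E.
by apply: (addrI ((q - 1) * w)); rewrite E; ring.
Qed.

Lemma sum_slope_sqr :
  \sum_(z | z != 0) slope z ^+ 2 = w ^+ 2 * (P - 1) + w * (q - 1) * P.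
Proof.
do 2! apply: (mulfI (qB1_neq0 F)); rewrite !mulr_sumr.
rewrite (eq_bigr (fun z => h z * h z)) => [|z /slopeE[-> _]]; last by ring.
have := sum_hyp_weight_nz_sqr; rewrite (bigD1 0) //= hyp_weight_nz0 => E.
apply: (addrI ((q - 1) * w * ((q - 1) * w))); rewrite E; ring.
Qed.

(** Expressing P through theta exposes the factor (q - 1)^2 to be cancelled, and the binomials
    absorb the factor 2 coming from [rho_binE]. *)
Lemma rho_bin_identity theta : P = 1 + (q - 1) * theta -> exists B,
  (q + 1) * B = choose2 (x - w) * ((1 + q + q ^+ 2 * theta) * theta)
    + (x - w) * w * ((1 + q * theta) * (theta - 1))
    + choose2 w * (theta * (theta - 1 - q)) + w * choose2 q * (theta * (1 +
      q * theta)).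
Proof.
move=> PE; have [B BE] := dvd_sum_rho_bin; exists B.
(* Coefficients of s^2, s and 1 in [sum_rho_bin] after substituting h = (q - 1) s and K = x - w + q
   s, where s is [slope z]. *)
pose f2 := q * P - q ^+ 3.
pose f1 := 2 * (x - w) * q * (q * P - q) +
  q * (q - q * P) - 2 * (x - w) * (q * P) * (q - 1)
  + (q * P + q ^+ 2 * P) * (q - 1).
pose f0 := (x - w) ^+ 2 * (q * P - q) + (x - w) * (q - q * P).
have E : 2 * ((q ^+ 2 - 1) * (q ^+ 2 - q) * B) =
    f2 * (w ^+ 2 * (P - 1) + w * (q - 1) * P) + f1 * (w * (q * P - 1)) +
      f0 * (q ^+ 2 * P - 1).
  rewrite -BE -sum_slope_sqr -sum_slope.
  have -> : q ^+ 2 * P - 1 = \sum_(z : vec | z != 0) 1.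
    by have := sum_row1 F N; rewrite expN => <-;
      rewrite [X in X - _](bigD1 0) //= addrAC subrr add0r.
  rewrite (bigD1 0) //= big1 ?add0r => [|z2 _];
    last by rewrite /indep eqxx mul0r.
  rewrite !mulr_sumr -!big_split /=; apply: eq_bigr => z zN0.
  rewrite sum_rho_bin //; have [-> ->] := slopeE zN0.
  by rewrite /f2 /f1 /f0; ring.
have two_neq0 : (2 : int) != 0 by [].
apply: (mulfI two_neq0); apply: (mulfI (q_neq0 F)).
do 2! apply: (mulfI (qB1_neq0 F)).
transitivity (2 * ((q ^+ 2 - 1) * (q ^+ 2 - q) * B)); first by ring.
rewrite E /f2 /f1 /f0 PE.
set b1 := choose2 (x - w); set b2 := choose2 w; set b3 := choose2 q.
transitivity ((q - 1) * ((q - 1) * (q * (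
   (2 * b1) * ((1 + q + q ^+ 2 * theta) * theta)
    + 2 * (x - w) * w * ((1 + q * theta) * (theta - 1))
    + (2 * b2) * (theta * (theta - 1 - q)) + w * (2 * b3) * (theta * (1 +
      q * theta)))))).
  by rewrite !choose2E; ring.
by ring.
Qed.

(** [th] is 1 + q + ... + q^(k-1), which modulo q + 1 is an alternating sum of k signs. *)
Lemma geometric_mod (k : nat) : exists th, exists j : int,
  q ^+ k = 1 + (q - 1) * th /\ th = (q + 1) * j + ind (odd k).
Proof.
elim: k => [|k [th [j [E1 E2]]]]; first by exists 0, 0; split;
  rewrite ?expr0 //=; ring.
exists (1 + q * th); rewrite /=; case: (odd k) E2 => /= E2.
  by exists (1 + q * j); split; rewrite ?exprS ?E1 E2; ring.
by exists (q * j); split; rewrite ?exprS ?E1 E2; ring.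
Qed.

Theorem weight_congruence :
  (odd m -> (q + 1 %| choose2 x + w * (w - x))%Z) /\
  (~~ odd m -> (q + 1 %| w * (w - x))%Z).
Proof.
have [th [j [PE thE]]] := geometric_mod m.
have [B BE] := rho_bin_identity PE.
have bE : choose2 x + w * (w - x) = choose2 (x - w) + choose2 w.
  have two_neq0 : (2 : int) != 0 by [].
  by apply: (mulfI two_neq0); rewrite !mulrDr !choose2E; ring.
split=> m_odd; apply/dvdzP; move: thE; rewrite ?m_odd ?(negPf m_odd) /= => thE;
  rewrite ?bE.
  (* Modulo q + 1 one has q = -1 and th = 1, and the four coefficients in [BE] become 1, 0, 1, 0. *)
  exists (B - choose2 (x - w) * (th + (q - 1) * th ^+ 2 + j * (th + 1))
    - (x - w) * w * (j * (1 + q * th)) - choose2 w * (j * (th + 1) - th)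
    - w * choose2 q * (th * (1 + q * j))).
  by rewrite [RHS]mulrC !mulrBr BE thE; ring.
(* Now th = 0 modulo q + 1, and the four coefficients become 0, -1, 0, 0. *)
exists (B - choose2 (x - w) * ((1 + q + q ^+ 2 * th) * j)
  - (x - w) * w * (j * (1 + q * th - q)) - choose2 w * (j * (th - 1 - q))
  - w * choose2 q * (j * (1 + q * th))).
by rewrite [RHS]mulrC !mulrBr BE thE; ring.
Qed.
End Invariant.

(** * Coordinates adapted to a generator *)

Section Interleave.
Variables (F : finFieldType) (m : nat).
Notation N := m.+2.
Notation W := 'rV[F]_(N + N).
Notation V := 'rV[F]_(2 * m.+1).+2.

Definition interleave (p : W) : V :=
  \row_k (if odd k then rsubmx p 0 (inord k./2) else lsubmx p 0 (inord k./2)).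

Lemma interleaveD p p' : interleave (p + p') = interleave p + interleave p'.
Proof. by apply/rowP => k; rewrite !mxE; case: ifP. Qed.

Lemma interleaveZ a p : interleave (a *: p) = a *: interleave p.
Proof. by apply/rowP => k; rewrite !mxE; case: ifP. Qed.

Lemma interleave0 : interleave 0 = 0.
Proof. by rewrite -[0 in LHS](scale0r 0) interleaveZ scale0r. Qed.

Lemma hyp_form_interleave p : hyp_form (interleave p) = qf p.
Proof.
rewrite /hyp_form /qf /dot mxE; apply: eq_bigr => i _.
have i_lt := ltn_ord i.
rewrite !mxE !inordK; [|lia..].
have -> : odd (2 * i) = false by lia.
have -> : odd (2 * i).+1 by lia.
have -> : ((2 * i).+1./2 = i)%N by lia.
have -> : ((2 * i)./2 = i)%N by lia.
by rewrite inord_val.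
Qed.

Lemma hyp_bilin_interleave p p' :
  hyp_bilin (interleave p) (interleave p') = bil p p'.
Proof. by rewrite /hyp_bilin -interleaveD !hyp_form_interleave qfD; ring. Qed.

Lemma bil_nondegenerate p : (forall p', bil p' p = 0) -> p = 0 :> W.
Proof.
move=> H; apply/eqP; apply: contraT; rewrite -sw_eq0 => /exists_dot[u].
by rewrite -/(bil u p) H eqxx.
Qed.

Lemma interleave_bij : bijective interleave.
Proof.
apply: inj_card_bij; last by rewrite !card_mx !mul1n (_ : (2 * m.+1).+2 =
  N + N)%N //; lia.
move=> p p' E; apply/eqP; rewrite -subr_eq0; apply/eqP/bil_nondegenerate => u.
rewrite -hyp_bilin_interleave -scaleN1r interleaveD interleaveZ E scaleN1r
  subrr.
by rewrite -interleave0 hyp_bilin_interleave bil0r.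
Qed.
End Interleave.

Section Generator.
Variables (F : finFieldType) (m : nat).
Notation N := m.+2.
Notation W := 'rV[F]_(N + N).
Notation V := 'rV[F]_(2 * m.+1).+2.
Notation q := (#|F|%:Z).
Variable G : {vspace V}.
Hypothesis hG : generator G.

Let U (p : W) := interleave p \in G.

Lemma generator_closed l u v : U u -> U v -> U (u + l *: v).
Proof. by rewrite /U interleaveD interleaveZ => *; rewrite rpredD ?rpredZ. Qed.

Lemma generator_singular u : U u -> qf u = 0.
Proof. by move=> Uu; rewrite -hyp_form_interleave (proj1 hG). Qed.

Lemma generator_perp u v : U u -> U v -> bil u v = 0.
Proof.
move=> Uu Uv; have := generator_singular (generator_closed 1 Uu Uv).
by rewrite scale1r qfD !generator_singular // !add0r.
Qed.

Lemma generator_maximal e : qf e = 0 -> (forall u, U u -> bil u e = 0) -> U e.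
Proof.
move=> fe ue; rewrite /U -(proj2 hG (G + <[interleave e]>)%VS) ?addvSl //.
  by apply: (subvP (addvSr _ _)); apply: memv_line.
move=> v /memv_addP[g gG [_ /vlineP[a ->] ->]].
have [f fK Kf] := interleave_bij F m.
rewrite -(Kf g) -interleaveZ -interleaveD hyp_form_interleave qfD qfZ fe bilZr.
have Ug : U (f g) by rewrite /U Kf.
by rewrite ue // generator_singular // !mulr0 !addr0.
Qed.

(** Orthogonal pairs between U and the standard generator E are counted twice. By maximality of G,
    the elements of E orthogonal to U are those in U; likewise the elements of U orthogonal to E are
    those in E. Equating the counts gives (|U| - |E|) |E :&: U| = 0, and the intersection contains
    0. *)
Lemma sum_generator : \sum_u ind (U u) = q ^+ N.
Proof.
pose E (e : W) := rsubmx e == 0.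
have Ec l u v : E u -> E v -> E (u + l *: v).
  by move=> /eqP u0 /eqP v0; rewrite /E linearD linearZ /= u0 v0 scaler0 addr0.
have E1 : \sum_e ind (E e) = q ^+ N.
  rewrite sum_row_mx -sum_row1; apply: eq_bigr => g _.
  rewrite -[RHS](sum_pick (0 : 'rV[F]_N) (fun=> 1)).
  by apply: eq_bigr => z _; rewrite /E row_mxKr mulr1.
pose I := \sum_e ind (E e && U e).
have I_gt0 : 0 < I.
  rewrite /I (bigD1 0) //= ltr_pwDl ?sumr_ge0 // => [|e _];
    last by rewrite /ind; case: ifP.
  by rewrite /E linear0 eqxx /U interleave0 mem0v.
have L : q * \sum_e ind (E e) * \sum_u ind (U u) * ind (bil u e == 0) =
   (\sum_u ind (U u)) * (q ^+ N + (q - 1) * I).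
  rewrite -E1 !mulr_sumr -big_split mulr_sumr /=; apply: eq_bigr => e _.
  rewrite mulrCA sum_subspace_perp; last exact: generator_closed.
  rewrite indM.
  transitivity (ind (E e) * ((\sum_u ind (U u)) * (1 + (q - 1) * ind (U e))));
    last by ring.
  apply: ind_mull => /eqP e0; congr (_ * (1 + _ * ind _)).
  apply/forallP/idP => [A|Ue u]; last by apply/implyP => Uu;
    rewrite generator_perp.
  apply: generator_maximal => [|u Uu]; first by rewrite /qf e0 dot0r.
  by apply/eqP; have := A u; rewrite Uu.
have R : q * \sum_u ind (U u) * \sum_e ind (E e) * ind (bil e u == 0) =
   q ^+ N * (\sum_u ind (U u) + (q - 1) * I).
  rewrite !mulr_sumr -big_split mulr_sumr /=; apply: eq_bigr => u _.
  rewrite mulrCA sum_subspace_perp // E1 andbC indM.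
  transitivity (ind (U u) * (q ^+ N * (1 + (q - 1) * ind (E u)))); last by ring.
  congr (_ * (_ * (1 + _ * ind _))).
  apply/forallP/idP => [A|/eqP u0 e]; last first.
    by apply/implyP => /eqP e0; rewrite bilE e0 u0 !dot0r addr0.
  apply: contraT => /exists_dot[g gN].
  have := A (row_mx g 0); rewrite /E row_mxKr eqxx /= bilE row_mxKl row_mxKr.
  by rewrite dot0r addr0 (negPf gN).
have LR : \sum_e ind (E e) * \sum_u ind (U u) * ind (bil u e == 0) =
  \sum_u ind (U u) * \sum_e ind (E e) * ind (bil e u == 0).
  rewrite sum_swap_mul; apply: eq_bigr => u _; rewrite mulr_sumr.
  by apply: eq_bigr => e _; rewrite bilC; ring.
apply: (mulfI (lt0r_neq0 I_gt0)); apply: (mulfI (qB1_neq0 F)).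
move: L; rewrite LR R; set u1 := \sum_u _ => L.
apply: (addrI (u1 * q ^+ N)).
transitivity (u1 * (q ^+ N + (q - 1) * I)); first by ring.
by rewrite -L; ring.
Qed.

Lemma dim_generator : \dim G = N.
Proof.
apply/eqP; rewrite -(eqn_exp2l _ _ (finNzRing_gt1 F)) -eqz_nat.
rewrite -card_vspace -[(_ ^ N)%N%:Z]natz natrX natz -sum_generator.
rewrite -[X in X%:Z == _]sum1_card (big_morph Posz PoszD (erefl 0)) big_mkcond
  /=.
rewrite (reindex (@interleave F m)); last exact/onW_bij/interleave_bij.
by apply/eqP; apply: eq_bigr => u _; rewrite /U /ind; case: ifP.
Qed.

Lemma generator_basis : exists2 Gm : 'M[F]_(N, N + N),
  row_free Gm & forall g : 'rV[F]_N, U (g *m Gm).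
Proof.
have [b bG] : exists b : N.-tuple V, basis_of G b.
  by rewrite -dim_generator; exists (vbasis G); apply: vbasisP.
have [f fK Kf] := interleave_bij F m.
pose Gm := \matrix_(i < N) f b`_i.
have GmE g : interleave (g *m Gm) = \sum_i g 0 i *: b`_i.
  rewrite mulmx_sum_row.
  rewrite (big_morph _ (@interleaveD F m) (@interleave0 F m)).
  by apply: eq_bigr => i _; rewrite interleaveZ rowK Kf.
exists Gm => [|g]; last first.
  rewrite /U GmE; apply: rpred_sum => i _; rewrite rpredZ //.
  by apply: (basis_mem bG); rewrite mem_nth ?size_tuple.
apply: inj_row_free => g g0; apply/rowP => i.
rewrite mxE -(coord_sum_free (fun i => g 0 i) i (basis_free bG)) -GmE g0.
by rewrite interleave0 linear0.
Qed.

(* The complement z |-> sw (z B^T), dual to G, becomes totally singular after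
   subtracting the element of G whose pairing with z is its quadratic form. *)
Lemma generator_isometry : exists2 psi : W -> V,
  [/\ bijective psi, forall p p', psi (p + p') = psi p + psi p'
    & forall a p, psi (a *: p) = a *: psi p] &
  (forall p, hyp_form (psi p) = qf p) /\ (forall p,
    (psi p \in G) = (rsubmx p == 0)).
Proof.
have [Gm /row_freeP[B GB] GmU] := generator_basis.
pose beta : 'M_N := rsubmx B^T *m (lsubmx B^T)^T.
pose phi (p : W) : W := (lsubmx p - rsubmx p *m beta) *m Gm +
  sw (rsubmx p *m B^T).
have phiD p p' : phi (p + p') = phi p + phi p'.
  rewrite /phi [lsubmx (p + p')]linearD [rsubmx (p + p')]linearD /=.
  rewrite !(mulmxDl (rsubmx p)) swD opprD [_ + _ + (- _ - _)]addrACA mulmxDl.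
  exact: addrACA.
have phiZ a p : phi (a *: p) = a *: phi p.
  by rewrite /phi !linearZ /= -!scalemxAl swZ -scalerBr -scalemxAl scalerDr.
have bilG g z : bil (g *m Gm) (sw (z *m B^T)) = dot g z.
  by rewrite /bil swK /dot trmx_mul trmxK mulmxA -(mulmxA g) GB mulmx1.
have qf_phi p : qf (phi p) = qf p.
  rewrite /phi qfD generator_singular ?GmU // add0r bilG.
  have -> : qf (sw (rsubmx p *m B^T)) = dot (rsubmx p *m beta) (rsubmx p).
    rewrite /qf /sw row_mxKl row_mxKr -[B^T]hsubmxK mul_mx_row row_mxKl
      row_mxKr.
    by rewrite /beta /dot trmx_mul !mulmxA.
  by rewrite -scaleN1r dotDl dotZl mulN1r /qf addrC subrK.
have bil_phi p p' : bil (phi p) (phi p') = bil p p'.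
  have := qf_phi (p + p'); rewrite phiD (qfD (phi p)) (qfD p) !qf_phi.
  by move=> /addrI.
have phi_bij : bijective phi.
  apply: injF_bij => p p' E; apply/eqP; rewrite -subr_eq0; apply/eqP.
  apply: bil_nondegenerate => u; rewrite -bil_phi -scaleN1r phiD phiZ E.
  by rewrite scaleN1r subrr bil0r.
exists (@interleave F m \o phi); split=> /=.
- by apply: bij_comp => //; apply: interleave_bij.
- by move=> p p'; rewrite phiD interleaveD.
- by move=> a p; rewrite phiZ interleaveZ.
- by move=> p; rewrite hyp_form_interleave.
move=> p; apply/idP/eqP => [Up|p0]; last first.
  rewrite /phi p0 !mul0mx subr0.
  have -> : sw (0 : W) = 0 by apply/eqP; rewrite sw_eq0.
  by rewrite addr0; apply: GmU.
(* Vectors of G pair with the image of p as g.z, and G is orthogonal to itself. *)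
apply/eqP; apply: contraT => /exists_dot[g]; rewrite -bilG => /eqP[].
have := generator_perp (GmU g) Up.
by rewrite /phi bilC bilDl -!(bilC (g *m Gm)) generator_perp // add0r.
Qed.
End Generator.

(** * The congruence *)

Lemma vline_eq (F : finFieldType) (d : nat) (P : {vspace 'rV[F]_d}) v :
  \dim P = 1%N -> v != 0 -> (<[v]>%VS == P) = (v \in P).
Proof. by move=> dP vN0; rewrite eqEdim dP dim_vline vN0 andbT memvE. Qed.

Lemma sum_points (F : finFieldType) (d : nat) (T : {set {vspace 'rV[F]_d}})
    (Phi : {vspace 'rV[F]_d} -> int) :
  (forall P, P \in T -> \dim P = 1%N) ->
  \sum_(v : 'rV[F]_d) ind (v != 0) * (ind (<[v]>%VS \in T) * Phi <[v]>%VS) =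
  (#|F|%:Z - 1) * \sum_(P in T) Phi P.
Proof.
move=> T1; rewrite mulr_sumr [RHS]big_mkcond /=.
transitivity (\sum_P \sum_(v : 'rV[F]_d) ind (<[v]>%VS == P) * (ind (v != 0) *
  (ind (P \in T) * Phi P))).
  by rewrite exchange_big; apply: eq_bigr => v _ /=; rewrite sum_pickr.
apply: eq_bigr => P _; case: ifP => PT; last first.
  by rewrite big1 // => v _; rewrite mul0r !mulr0.
transitivity (\sum_(v : 'rV[F]_d) ind (v != 0) * (ind (v \in P) * Phi P)).
  apply: eq_bigr => v _; rewrite mulrCA; apply: ind_mull => vN0.
  by rewrite vline_eq ?T1 // mul1r.
rewrite sum_indD0 mem0v mul1r -mulr_suml.
have -> : \sum_v ind (v \in P) = #|P|%:Z.
  by rewrite -[RHS]natz -sumr_const [RHS]big_mkcond; apply: eq_bigr => v _;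
    case: (v \in P).
by rewrite card_vspace T1 // expn1; ring.
Qed.

(** Homogeneity of [hyp_bilin] is a hypothesis here; it is supplied later by transport from
    [bil]. *)
Lemma mem_perp_line (F : finFieldType) (n : nat) (u v : 'rV[F]_(2 * n).+2) :
  (forall a y, hyp_bilin (a *: u) y = a * hyp_bilin u y) ->
  (forall a y, hyp_bilin y (a *: v) = a * hyp_bilin y v) ->
  v != 0 -> (<[v]>%VS \in perp <[u]>%VS) = (hyp_bilin u v == 0).
Proof.
move=> Zl Zr vN0; rewrite inE dim_vline vN0 eqxx /=.
apply/forallP/eqP => [A|uv u'].
  have /forallP/(_ v) := A u; rewrite !memv_line /=.
  by move=> /eqP.
apply/forallP => v'; apply/implyP => /vlineP[a ->];
  apply/implyP => /vlineP[b ->].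
by rewrite Zl Zr uv !mulr0.
Qed.

Lemma theta_mul (q n : nat) : (1 < q)%N ->
  (q%:Z - 1) * (theta q n)%:Z = q%:Z ^+ n.+1 - 1.
Proof.
move=> q1; rewrite /theta subn1 predn_exp subn1 mulKn; last by lia.
rewrite -predn_int; last by lia.
rewrite -PoszM -predn_exp predn_int ?expn_gt0; last by lia.
by rewrite -[(q ^ n.+1)%N%:Z]natz natrX natz.
Qed.

(** The denominator q^(n+1) - 1 = (q - 1) theta cancels against |T| = x theta. For the empty set,
    where no average is available, both sides are 0. *)
Lemma tight_sum (F : finFieldType) (n : nat) (T : {set {vspace 'rV[F]_(2 *
  n).+2}})
    (x : nat) : tight_with_parameter T x ->
  (#|F|%:Z - 1) * (\sum_(P in T) #|perp P :&: T|)%:Z =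
  #|T|%:Z * (x%:Z * (#|F|%:Z ^+ n - 1) + (#|F|%:Z - 1) * #|F|%:Z ^+ n).
Proof.
move=> [[_ tT] cT]; have [T0|/eqP TN] := eqVneq T set0.
  by rewrite T0 big_set0 cards0 mulr0 mul0r.
have toQ (k : nat) : (k%:Z)%:~R = k%:R :> rat by [].
have th : ((#|F|%:R - 1) * (theta #|F| n)%:R = #|F|%:R ^+ n.+1 - 1 :> rat).
  have := congr1 (intr : int -> rat) (theta_mul n (finNzRing_gt1 F)).
  by rewrite intrM !intrB rmorphXn /= !toQ.
have cN : (#|T|%:R : rat) != 0 by rewrite pnatr_eq0 cards_eq0; apply/eqP.
have cTr : #|T|%:R = x%:R * (theta #|F| n)%:R :> rat by rewrite cT natrM.
have thN : (theta #|F| n)%:R != 0 :> rat.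
  by move: cN; rewrite cTr mulf_eq0 negb_or => /andP[].
have qN : #|F|%:R - 1 != 0 :> rat.
  by rewrite subr_eq0 pnatr_eq1 neq_ltn finNzRing_gt1 orbT.
apply: (@intr_inj rat); rewrite !(intrM, intrD, intrB, rmorphXn) /= !toQ.
rewrite natr_sum; have := tT TN; rewrite /average => /(canRL (divfK cN)) ->.
rewrite -th cTr; field.
by rewrite qN thN.
Qed.

Theorem theorem1p2 (F : finFieldType) (n : nat) (hn : (1 <= n)%N)
    (T : {set {vspace 'rV[F]_(2 * n).+2}}) (x : nat)
    (hT : tight_with_parameter T x)
    (G : {vspace 'rV[F]_(2 * n).+2}) (hG : generator G) :
  let q := #|F| in
  let w := #|points_in G :&: T| in
  (~~ odd n ->
     ('C(x, 2)%:Z + w%:Z * (w%:Z - x%:Z) = 0 %[mod (q + 1)%N%:Z])%Z) /\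
  (odd n ->
     (w%:Z * (w%:Z - x%:Z) = 0 %[mod (q + 1)%N%:Z])%Z).
Proof.
(* With n = m + 1, generators have vector dimension m + 2 and P = q^m is |S|; n is even exactly when
   m is odd. *)
move=> q0 w; case: n hn => // m _ in T hT G hG q0 w *.
have [psi [psi_bij psiD psiZ] [psi_form psiG]] := generator_isometry hG.
have Tpt P : P \in T -> \dim P = 1%N by move=> PT;
  have [] := (proj1 (proj1 hT)) P PT.
have Tsing P : P \in T -> tot_singular P by move=> PT;
  have [] := (proj1 (proj1 hT)) P PT.
have psi0 : psi 0 = 0 by rewrite -[0 in LHS](scale0r 0) psiZ scale0r.
have psi_eq0 p : (psi p == 0) =
  (p == 0) by rewrite -psi0 (inj_eq (bij_inj psi_bij)).
have psi_bil p p' : hyp_bilin (psi p) (psi p') = bil p p'.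
  by rewrite /hyp_bilin -psiD !psi_form qfD; ring.
have sum_psi (Phi : 'rV[F]_(2 * m.+1).+2 -> int) : \sum_v Phi v =
  \sum_p Phi (psi p).
  by rewrite (reindex psi) //; apply: onW_bij.
pose q := #|F|%:Z; pose P := q ^+ m.
(* The value x at 0 makes tau (U^perp) proportional to tau (U). *)
pose tau p : int := if p == 0 then x%:Z else ind (<[psi p]>%VS \in T).
have tau0 : tau 0 = x%:Z by rewrite /tau eqxx.
have tauN p : ind (p != 0) * tau p = ind (p != 0) * ind (<[psi p]>%VS \in T).
  by apply: ind_mull => /negPf pN; rewrite /tau pN.
have tauS p : ind (qf p == 0) * tau p = tau p.
  rewrite /tau; have [->|pN0] := eqVneq p 0;
    first by rewrite /qf linear0 dot0l eqxx mul1r.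
  case: (boolP (_ \in T)) => [pT|_]; last by rewrite mulr0.
  by rewrite -psi_form (Tsing _ pT) ?memv_line // eqxx.
have tauZ a p : a != 0 -> tau (a *: p) = tau p.
  move=> aN0; rewrite /tau scaler_eq0 (negPf aN0) /=;
    case: ifP => // /negbT pN0.
  suff -> : <[psi (a *: p)]>%VS = <[psi p]>%VS by [].
  apply/eqP; rewrite vline_eq ?dim_vline ?psi_eq0 ?scaler_eq0 ?(negPf aN0) ?pN0
    //.
  by rewrite psiZ memvZ // memv_line.
have tau01 p : p != 0 -> tau p * tau p = tau p.
  by move=> /negPf pN0; rewrite /tau pN0; case: (_ \in T).
have [_ cT] := hT.
have qT : (q - 1) * #|T|%:Z = x%:Z * (q ^+ 2 * P - 1).
  rewrite cT PoszM mulrCA theta_mul ?finNzRing_gt1 //.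
  by rewrite /P -exprD.
have tau_weight (Phi : {vspace 'rV[F]_(2 * m.+1).+2} -> int) :
    \sum_p ind (p != 0) * (tau p * Phi <[psi p]>%VS) =
      (q - 1) * \sum_(P in T) Phi P.
  rewrite -sum_points // sum_psi; apply: eq_bigr => p _.
  by rewrite mulrA tauN -mulrA psi_eq0.
have tau_total : \sum_p tau p = x%:Z * (q ^+ 2 * P).
  have := tau_weight (fun=> 1); under eq_bigr do rewrite mulr1.
  rewrite sum_indD0 tau0 sumr_const natz qT => E.
  by rewrite -(subrK x%:Z (\sum_p tau p)) E; ring.
have tau_perp : \sum_u tau u * perp_weight tau u =
  x%:Z ^+ 2 + 2 * x%:Z * (x%:Z * (q ^+ 2 * P - 1)) +
  x%:Z * (q ^+ 2 * P - 1) * (x%:Z * (q * P - 1) + (q - 1) * (q * P)).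
  pose S := \sum_(P in T) #|perp P :&: T|%:Z.
  have SE : S = (\sum_(P in T) #|perp P :&: T|)%:Z.
    by rewrite /S (big_morph Posz PoszD (erefl 0)).
  have DE u : u != 0 -> perp_weight tau u =
    x%:Z + (q - 1) * #|perp <[psi u]>%VS :&: T|%:Z.
    move=> uN0; rewrite /perp_weight.
    have -> : #|perp <[psi u]>%VS :&: T|%:Z =
      \sum_(Q in T) ind (Q \in perp <[psi u]>%VS).
      rewrite -[LHS]natz -sumr_const; rewrite [LHS]big_mkcond [RHS]big_mkcond;
        apply: eq_bigr => Q _ /=.
      by rewrite in_setI andbC /ind; case: (Q \in T).
    rewrite -tau_weight -[LHS](subrK (ind (bil u 0 == 0) * tau 0)) -(sum_indD0
      0 (fun v => ind (bil u v == 0) * tau v)).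
    rewrite bil0r eqxx mul1r tau0 addrC; congr (_ + _); apply: eq_bigr => v _.
    apply: ind_mull => vN0; rewrite mulrC; congr (_ * ind _).
    rewrite mem_perp_line ?psi_bil ?psi_eq0 //.
    - move=> a y; have [f _ Kf] := psi_bij; rewrite -(Kf y) -psiZ !psi_bil.
      exact: bilZl.
    - move=> a y; have [f _ Kf] := psi_bij; rewrite -(Kf y) -psiZ !psi_bil.
      exact: bilZr.
  rewrite (bigD1 0) //= tau0 (perp_weight0 tau_total).
  have -> : \sum_(u | u != 0) tau u * perp_weight tau u =
     \sum_u ind (u != 0) * (tau u * (x%:Z +
       (q - 1) * #|perp <[psi u]>%VS :&: T|%:Z)).
    rewrite big_mkcond; apply: eq_bigr => u _; rewrite /ind; case: ifP => uN0;
      last by rewrite mul0r.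
    by rewrite mul1r DE.
  rewrite (tau_weight (fun P => x%:Z + (q - 1) * #|perp P :&: T|%:Z)).
  rewrite big_split /= -mulr_sumr -/S SE sumr_const -mulr_natl natz.
  have := tight_sum hT; rewrite -/q exprS -/P => ->.
  transitivity (x%:Z * (x%:Z * (q ^+ 2 * P)) + (q - 1) * #|T|%:Z * x%:Z +
    (q - 1) * #|T|%:Z * (x%:Z * (q * P - 1) + (q - 1) * (q * P))).
    by ring.
  by rewrite qT; ring.
have tau_gen : \sum_(g : 'rV[F]_m.+2) tau (row_mx g 0) = x%:Z + (q - 1) * w%:Z.
  have wE : w%:Z = \sum_(Q in T) ind (Q <= G)%VS.
    rewrite -[LHS]natz -sumr_const; rewrite [LHS]big_mkcond [RHS]big_mkcond;
      apply: eq_bigr => Q _ /=.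
    rewrite in_setI andbC inE /ind; case: (boolP (Q \in T)) => QT //=.
    by rewrite Tpt.
  rewrite wE -tau_weight.
  transitivity (x%:Z + \sum_p ind (p != 0) * (tau p * ind (rsubmx p == 0))).
    rewrite sum_indD0 linear0 eqxx tau0 mulr1 addrC subrK sum_row_mx
      exchange_big /=.
    rewrite -[LHS](sum_pick (0 : 'rV[F]_m.+2) (fun z =>
      \sum_g tau (row_mx g z))).
    apply: eq_bigr => z _; rewrite mulr_sumr; apply: eq_bigr => g _.
    by rewrite row_mxKr mulrC.
  by congr (_ + _); apply: eq_bigr => p _; rewrite -memvE psiG.
have tau_sub := subspace_perp_weight tau0 tauS tauZ tau01 tau_total tau_perp.
have [even odd] := weight_congruence tau0 tauS tauZ tau_sub tau01 tau_gen.
have binE : 'C(x, 2)%:Z = choose2 x%:Z.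
  have two_neq0 : (2 : int) != 0 by [].
  apply: (mulfI two_neq0); rewrite choose2E.
  case: x {hT cT qT tau tau0 tauN tauS tauZ tau01 tau_weight tau_total tau_perp
    tau_gen tau_sub even odd} => [|x] //.
  have := mul_bin_diag x.+1 1; rewrite /= bin1 => /esym.
  by move=> /(congr1 Posz); rewrite !PoszM => ->; congr (_ * _); lia.
rewrite /= negbK; split=> n_odd.
  by apply/eqP; rewrite eqz_mod_dvd subr0 binE PoszD; apply: even.
by apply/eqP; rewrite eqz_mod_dvd subr0 PoszD; apply: odd.
Qed.
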